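(* Let $h:[0,1]\to(0,\infty)$ and $f:[0,\infty)\to[0,\infty)$ be continuously differentiable, suppose there is $t_0\ge0$ with $f>0$ on $[t_0,\infty)$ and $f\in C^2([t_0,\infty))$, put $g=\log f$ on $[t_0,\infty)$, and assume condition (H1) of the context with $q>2$. Let $(\lambda_n,\mu_n,u_n)\in(0,\infty)\times(0,\infty)\times C^2([0,1])$ satisfy $-u_n''-\frac1r u_n'=\lambda_n h(r)f(u_n)$, $u_n>0$ in $(0,1)$, $u_n(0)=\mu_n$, $u_n'(0)=0=u_n(1)$, with $\mu_n\to\infty$. Then $$\lim_{n\to\infty} g'(\mu_n)\int_0^1\lambda_n h f(u_n)\,r\,dr=4=\lim_{n\to\infty}\int_0^1\lambda_n h f'(u_n)\,r\,dr,$$ $$g'(\mu_n)u_n(r)\to 4\log\frac1r\ \text{ in } C^2_{\mathrm{loc}}((0,1]),$$ and $$\lim_{n\to\infty}\frac{\log\frac1{\lambda_n}}{g(\mu_n)}=\frac{2-p}{2}.$$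
   Context: Condition (H1): (i) $g'(t)>0$ and $g''(t)>0$ for all $t\ge t_0$, and there is a pair $(q,p)$ with either $q=1$ and $p\in(0,\infty]$, or $q\in(1,\infty)$ and $p\in(0,\infty)$, such that $\lim_{t\to\infty}\frac{g'(t)^2}{g(t)g''(t)}=q$ and $\lim_{t\to\infty}\frac{tg'(t)}{g(t)}=p$; (ii) if $q=1$, then $tg'(t)/g(t)$ is nondecreasing on $[t_0,\infty)$ and there exist $k\in\mathbb{N}$, $\hat g\in C^2([t_0,\infty))$ with $f=\exp_k\circ\hat g$ and $\hat g'/\hat g$ nonincreasing. In integrals $h=h(r)$, $f(u_n)=f(u_n(r))$. *)

(* Defs.v *)
From Stdlib Require Import Reals.
From Coquelicot Require Import Coquelicot.
Open Scope R_scope.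

Definition has_deriv_on (D : R -> Prop) (f df : R -> R) : Prop :=
  forall x, D x ->
    filterlim (fun y => (f y - f x) / (y - x))
      (within (fun y => D y /\ y <> x) (locally x)) (locally (df x)).

Definition cont_on (D : R -> Prop) (f : R -> R) : Prop :=
  forall x, D x -> filterlim f (within D (locally x)) (locally (f x)).

Definition I01 (r : R) : Prop := 0 <= r <= 1.
Definition Ige (a : R) (t : R) : Prop := a <= t.

(* Main.v *)
Require Import Defs.
From Stdlib Require Import Reals Lra Psatz.
From Coquelicot Require Import Coquelicot.
Open Scope R_scope.

(** Write [G = g'(mu_n)], [m = - r u_n'], [X = G m] and [Y = G lam_n r^2 h f(u_n)]. With
    [D = r d/dr] the equation reads [D X = Y], [D Y = Y (2 + r h'/h - g'(u_n) m)] and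
    [D (G u_n) = - X]. As long as [r] is small and [u_n >= mu_n - (8/eps)/G], the factor
    [g'(u_n) m] is [X] up to a factor [1 - eps], so [(X, Y)] stays between two perturbations
    of the Liouville parabola [Y = 2 X - X^2/2]; hence [X] climbs to [4 - 3 eps] at some
    radius [r1], where [Y] is already of size [eps].

    Beyond [r1] the mass [X] can only grow, so [u_n] decreases at least at rate
    [(4 - 3 eps)/G] in [ln r]. Convexity of [g] gives [f(t) <= A exp(g(u1) t/u1)] for
    [t <= u1 = u_n(r1)], and [t g'(t)/g(t) -> p] turns this into
    [Y(r) <= C eps (r/r1)^(-(2/p - 1))]. The exponent is negative because [q > 2] forces
    [p < 2], so the mass gained beyond [r1] is [O(eps)]. All four limits follow: the
    last one by taking logarithms in the definition of [Y] at [r1]. *)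

(** * Monotonicity and continuity *)

(** No limiting Liouville profile is extracted: each estimate concerns one solution and one fixed
    [eps], and [n] enters only through the largeness of [mu_n]. The comparison on the bubble
    presupposes [u_n >= mu_n - (8/eps)/G], while this lower bound comes from the comparison itself;
    a continuity argument closes the loop. That [X] reaches [4 - 3 eps] inside a prescribed small
    disc is due to the Dirichlet condition: with less mass, [G u_n] could fall only by a bounded
    amount between that disc and [r = 1], whereas nearly all of [G mu_n] is left to lose. The level
    [4 - 3 eps] lies just below the nonzero root [4 - 2 eps] of the lower parabola
    [Y = (2 - eps) X - X^2/2], so that [Y >= (eps/2) X] during the whole climb. *)

Lemma nondecreasing_of_derive (F dF : R -> R) (a b : R) :
  a <= b ->
  (forall x, a <= x <= b -> continuous F x) ->
  (forall x, a < x < b -> is_derive F x (dF x)) ->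
  (forall x, a < x < b -> 0 <= dF x) ->
  F a <= F b.
Proof.
intros Hab Hc Hd Hpos.
(* The mean value point may be an endpoint, where nothing is known of [dF]; truncating at [0] makes
   its value there harmless. *)
destruct (MVT_gen F a b (fun x => Rmax 0 (dF x))) as [c [_ Hc']].
- intros x; rewrite Rmin_left, Rmax_right by easy; intros Hx.
  rewrite Rmax_right by now apply Hpos.
  now apply Hd.
- intros x; rewrite Rmin_left, Rmax_right by easy; intros Hx.
  now apply continuity_pt_filterlim, Hc.
- assert (0 <= Rmax 0 (dF c)) by apply Rmax_l; nra.
Qed.

Lemma nonincreasing_of_derive (F dF : R -> R) (a b : R) :
  a <= b ->
  (forall x, a <= x <= b -> continuous F x) ->
  (forall x, a < x < b -> is_derive F x (dF x)) ->
  (forall x, a < x < b -> dF x <= 0) ->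
  F b <= F a.
Proof.
intros Hab Hc Hd Hneg.
apply Ropp_le_cancel.
apply (nondecreasing_of_derive (fun x => - F x) (fun x => - dF x)); trivial.
- intros x Hx; apply (continuous_opp F); auto.
- intros x Hx; apply (is_derive_opp F); auto.
- intros x Hx; specialize (Hneg x Hx); lra.
Qed.

Lemma is_derive_value (F : R -> R) (x l l' : R) :
  is_derive F x l -> l = l' -> is_derive F x l'.
Proof. now intros H <-. Qed.

Lemma IVT_continuous (F : R -> R) (a b y : R) :
  a <= b -> (forall x, continuous F x) ->
  F a <= y <= F b \/ F b <= y <= F a -> exists x, a <= x <= b /\ F x = y.
Proof.
intros Hab Hc Hy.
destruct (IVT_gen F a b y) as [x [Hx Hx']].
- intros x; apply continuity_pt_filterlim, Hc.
- unfold Rmin, Rmax; destruct (Rle_dec (F a) (F b)); lra.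
- exists x; rewrite Rmin_left, Rmax_right in Hx by easy; easy.
Qed.

Lemma exp_le_mono x y : x <= y -> exp x <= exp y.
Proof.
intros [H|<-]; [now apply Rlt_le, exp_increasing|apply Rle_refl].
Qed.

Ltac cont :=
  repeat match goal with
  | H : forall x, continuous ?F x |- continuous ?F _ => apply H
  | H : forall x, continuous ?F x |- continuous (fun y => ?F y) _ => apply H
  | |- continuous (fun y => y) _ => apply continuous_id
  | |- continuous (fun y => ?c) _ => apply continuous_const
  | |- continuous (fun y => @?F y + @?G y) _ => apply (continuous_plus F G)
  | |- continuous (fun y => @?F y - @?G y) _ => apply (continuous_minus F G)
  | |- continuous (fun y => - @?F y) _ => apply (continuous_opp F)
  | |- continuous (fun y => @?F y * @?G y) _ => apply (continuous_mult F G)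
  | |- continuous (fun y => @?F y / ?c) _ => apply (continuous_mult F (fun _ => / c))
  | H : forall x, continuous ?F x |- continuous (fun y => ?F (@?G y)) _ =>
      apply (continuous_comp G F)
  | |- continuous (fun y => ln (@?F y)) _ => apply (continuous_comp F ln)
  | |- continuous ln _ => apply continuous_ln
  | |- continuous exp _ => apply continuous_exp
  | |- continuous (fun y => exp (@?F y)) _ => apply (continuous_comp F exp)
  end.

Ltac deriv H :=
  match type of H with
  | is_derive ?F ?x ?l => replace (Derive (fun y => F y) x) with l
      by (symmetry; apply is_derive_unique, H)
  end.

(** * The profile of a single solution *)

Section Profile.

Variables h dh f g dg u m : R -> R.
Variables lam mu T A hm hM p eps reps : R.

Hypothesis lam_pos : 0 < lam.
Hypothesis h_cont : forall r, continuous h r.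
Hypothesis h_der : forall r, 0 < r < 1 -> is_derive h r (dh r).
Hypothesis hm_pos : 0 < hm.
Hypothesis h_bnd : forall r, hm <= h r <= hM.
Hypothesis f_cont : forall t, continuous f t.
Hypothesis f_nonneg : forall t, 0 <= f t.
Hypothesis T_pos : 0 < T.
Hypothesis f_exp : forall t, T <= t -> f t = exp (g t).
Hypothesis f_der : forall t, T <= t -> is_derive f t (f t * dg t).
Hypothesis dg_pos : forall t, T <= t -> 0 < dg t.
Hypothesis dg_incr : forall a b, T <= a -> a <= b -> dg a <= dg b.
Hypothesis u_cont : forall r, continuous u r.
Hypothesis m_cont : forall r, continuous m r.
Hypothesis u_der : forall r, 0 < r < 1 -> is_derive u r (- (m r / r)).
Hypothesis m_der : forall r, 0 < r < 1 -> is_derive m r (lam * h r * f (u r) * r).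
Hypothesis m_0 : m 0 = 0.
Hypothesis u_0 : u 0 = mu.
Hypothesis u_1 : u 1 = 0.
Hypothesis p_range : 0 < p < 2.
Hypothesis eps_pos : 0 < eps.
(** This is [(1 + 2/p) (p + eps) <= (4 - 3 eps) (1 - eps)] with the term [3 eps^2] dropped on the
    right; it decides the decay beyond the bubble. *)
Hypothesis eps_le : eps * (8 + 2 / p) <= 2 - p.
Hypothesis eps_le4 : eps <= 1 / 4.
Hypothesis reps_range : 0 < reps < 1.
Hypothesis h_slow : forall r, 0 < r <= reps -> Rabs (r * dh r / h r) <= eps.

Let G := dg mu.
(** [G u] descends by at most [2/eps] per unit of [X], and [X < 4] on the bubble. *)
Let U := mu - 8 / eps / G.

Hypothesis mu_ge : T <= mu.
Hypothesis A_pos : 0 < A.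
Hypothesis near_T : forall t, U <= t <= mu -> T <= t.
Hypothesis near_dg : forall t, U <= t <= mu -> (1 - eps) * G <= dg t.
Hypothesis near_p : forall t, U <= t <= mu -> t * dg t <= (p + eps) * g t.
(** The added [1] later bounds [lam] itself, since [f] may vanish near [0]. *)
Hypothesis chord : forall x t, U <= x <= mu -> 0 <= t <= x ->
  f t + 1 <= A * exp (g x * t / x).
(** The right side is [G U]; the left side would bound [G * u reps] if [X] failed to reach
    [4 - 3 eps] by [reps]. *)
Hypothesis mu_large :
  (4 + 12 * (A * hM) / (hm * reps ^ 2)) / reps < G * mu - 8 / eps.

Let X r := G * m r.
Let Y r := G * (lam * (r * r) * h r * f (u r)).

Lemma G_pos : 0 < G.
Proof. now apply dg_pos. Qed.

Lemma h_pos r : 0 < h r.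
Proof. destruct (h_bnd r); lra. Qed.

Lemma m_incr a b : 0 <= a -> a <= b -> b <= 1 -> m a <= m b.
Proof.
intros Ha Hab Hb.
apply (nondecreasing_of_derive m (fun r => lam * h r * f (u r) * r)); trivial.
- intros x Hx; apply m_der; lra.
- intros x Hx; repeat apply Rmult_le_pos; try lra.
  + now apply Rlt_le, h_pos.
  + apply f_nonneg.
Qed.

Lemma m_nonneg r : 0 <= r <= 1 -> 0 <= m r.
Proof. intros Hr; rewrite <- m_0; apply m_incr; lra. Qed.

Lemma u_decr a b : 0 <= a -> a <= b -> b <= 1 -> u b <= u a.
Proof.
intros Ha Hab Hb.
apply (nonincreasing_of_derive u (fun r => - (m r / r))); trivial.
- intros x Hx; apply u_der; lra.
- intros x Hx.
  assert (0 <= m x / x).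
  { apply Rdiv_le_0_compat; [apply m_nonneg|]; lra. }
  lra.
Qed.

Lemma u_range r : 0 <= r <= 1 -> 0 <= u r <= mu.
Proof.
intros Hr; split; [rewrite <- u_1 | rewrite <- u_0]; apply u_decr; lra.
Qed.

Lemma X_cont r : continuous X r.
Proof. unfold X; cont. Qed.

Lemma Y_cont r : continuous Y r.
Proof. unfold Y; cont. Qed.

Lemma X_der r : 0 < r < 1 -> is_derive X r (Y r / r).
Proof.
intros Hr; unfold X, Y.
eapply is_derive_value.
- apply (is_derive_scal m r G), m_der, Hr.
- field; lra.
Qed.

Lemma Y_der r : 0 < r < 1 -> T <= u r ->
  is_derive Y r (Y r / r * (2 + r * dh r / h r - dg (u r) * m r)).
Proof.
intros Hr HT; unfold Y.
assert (Hh := h_pos r).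
assert (H1 := h_der r Hr). assert (H2 := u_der r Hr). assert (H3 := f_der _ HT).
auto_derive.
- repeat split; eexists; eassumption.
- deriv H1; deriv H2; deriv H3; field; lra.
Qed.

Lemma Y_nonneg r : 0 <= Y r.
Proof.
assert (HG := G_pos); assert (Hh := h_pos r).
assert (0 <= lam * (r * r)) by (apply Rmult_le_pos; [lra|apply (Rle_0_sqr r)]).
unfold Y; apply Rmult_le_pos; [lra|apply Rmult_le_pos; [|apply f_nonneg]].
apply Rmult_le_pos; lra.
Qed.

(** * Phase-plane comparison on the bubble *)

Lemma phase_slope r s : 0 < r < s -> s <= reps -> U <= u s ->
  (1 - eps) * X r <= dg (u r) * m r <= X r.
Proof.
intros Hr Hs HU.
assert (u s <= u r) by (apply u_decr; lra).
assert (0 <= u r <= mu) by (apply u_range; lra).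
assert (0 <= m r) by (apply m_nonneg; lra).
unfold X; split.
- rewrite <- Rmult_assoc; apply Rmult_le_compat_r; [easy|].
  apply near_dg; lra.
- apply Rmult_le_compat_r; [easy|].
  apply dg_incr; [apply near_T|]; lra.
Qed.

(* On the bubble the system r X' = Y, r Y' = Y (2 + O(eps) - (1 + O(eps)) X) is a
   perturbation of the Liouville one, whose first integral is Y - 2 X + X^2 / 2. *)
Lemma phase_curve s : 0 <= s <= reps -> U <= u s ->
  (2 - eps) * X s - X s * X s / 2 <= Y s
  <= (2 + eps) * X s - (1 - eps) * (X s * X s) / 2.
Proof.
intros Hs HU.
assert (Hder : forall r, 0 < r < s -> is_derive X r (Y r / r) /\
   is_derive Y r (Y r / r * (2 + r * dh r / h r - dg (u r) * m r))).
{ intros r Hr; split; [apply X_der; lra|].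
  apply Y_der; [lra|].
  apply near_T; split; [|apply u_range; lra].
  apply Rle_trans with (u s); trivial; apply u_decr; lra. }
assert (X0 : X 0 = 0) by (unfold X; rewrite m_0; ring).
assert (Y0 : Y 0 = 0) by (unfold Y; ring).
assert (HXc := X_cont). assert (HYc := Y_cont).
assert (Hsgn : forall r, 0 < r < s -> 0 <= Y r / r).
{ intros r Hr; apply Rdiv_le_0_compat; [apply Y_nonneg|lra]. }
assert (Heta : forall r, 0 < r < s -> - eps <= r * dh r / h r <= eps).
{ intros r Hr; apply Rabs_le_between, h_slow; lra. }
split.
(* The derivative is [Y / r] times the sum of [r * dh r / h r + eps] and [X r - dg (u r) * m r],
   both nonnegative; the upper curve uses the opposite bounds. *)
- assert (H : Y 0 - (2 - eps) * X 0 + X 0 * X 0 / 2 <= Y s - (2 - eps) * X s + X s * X s / 2).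
  2: rewrite X0, Y0 in H; lra.
  apply (nondecreasing_of_derive (fun r => Y r - (2 - eps) * X r + X r * X r / 2)
   (fun r => Y r / r * (r * dh r / h r + eps + (X r - dg (u r) * m r)))).
  + lra.
  + intros x _; cont.
  + intros r Hr; destruct (Hder r Hr) as [H1 H2].
    auto_derive; [repeat split; eexists; eassumption|].
    deriv H1; deriv H2.
    field; split; [apply Rgt_not_eq, h_pos|lra].
  + intros r Hr; apply Rmult_le_pos; [auto|].
    specialize (Heta r Hr); assert (H := phase_slope r s Hr (proj2 Hs) HU); lra.
- assert (H : Y s - (2 + eps) * X s + (1 - eps) * (X s * X s) / 2
    <= Y 0 - (2 + eps) * X 0 + (1 - eps) * (X 0 * X 0) / 2).
  2: rewrite X0, Y0 in H; lra.
  apply (nonincreasing_of_derive (fun r => Y r - (2 + eps) * X r + (1 - eps) * (X r * X r) / 2)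
   (fun r => Y r / r * (r * dh r / h r - eps + ((1 - eps) * X r - dg (u r) * m r)))).
  + lra.
  + intros x _; cont.
  + intros r Hr; destruct (Hder r Hr) as [H1 H2].
    auto_derive; [repeat split; eexists; eassumption|].
    deriv H1; deriv H2.
    field; split; [apply Rgt_not_eq, h_pos|lra].
  + intros r Hr; specialize (Heta r Hr); specialize (Hsgn r Hr).
    assert (H := phase_slope r s Hr (proj2 Hs) HU).
    assert (0 <= Y r / r * - (r * dh r / h r - eps + ((1 - eps) * X r - dg (u r) * m r))).
    { apply Rmult_le_pos; lra. }
    lra.
Qed.

Lemma X_incr a b : 0 <= a -> a <= b -> b <= 1 -> X a <= X b.
Proof.
intros; unfold X; apply Rmult_le_compat_l; [apply Rlt_le, G_pos|].
now apply m_incr.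
Qed.

Lemma X_nonneg r : 0 <= r <= 1 -> 0 <= X r.
Proof.
intros; unfold X; apply Rmult_le_pos; [apply Rlt_le, G_pos|].
now apply m_nonneg.
Qed.

(* The descent of [G u] is paid for by the growth of [X], since [Y >= (eps / 2) X]. *)
Lemma bubble_descent s : 0 <= s <= reps -> U <= u s -> X s <= 4 - 3 * eps ->
  G * (mu - u s) <= 2 / eps * X s.
Proof.
intros Hs HU HX.
assert (H : (- G) * u s - 2 / eps * X s <= (- G) * u 0 - 2 / eps * X 0).
2:{ rewrite u_0 in H; unfold X in H at 2; rewrite m_0 in H; lra. }
assert (HXc := X_cont).
apply (nonincreasing_of_derive (fun r => (- G) * u r - 2 / eps * X r)
   (fun r => 2 / eps / r * (eps / 2 * X r - Y r))).
- lra.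
- intros x _; cont.
- intros r Hr.
  assert (H1 : is_derive X r (Y r / r)) by (apply X_der; lra).
  assert (H2 : is_derive u r (- (m r / r))) by (apply u_der; lra).
  auto_derive; [repeat split; eexists; eassumption|].
  deriv H1; deriv H2.
  unfold X; field; lra.
- intros r Hr.
  destruct (phase_curve r) as [H1 _]; [lra| |].
  { apply Rle_trans with (1 := HU), u_decr; lra. }
  assert (X r <= X s) by (apply X_incr; lra).
  assert (0 <= X r) by (apply X_nonneg; lra).
  assert (0 <= 2 / eps / r).
  { apply Rdiv_le_0_compat; [apply Rdiv_le_0_compat|]; lra. }
  (* The lower phase curve gives [Y - (eps/2) X >= X (4 - 3 eps - X) / 2]. *)
  assert (0 <= X r * (4 - 3 * eps - X r)) by (apply Rmult_le_pos; lra).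
  assert (0 <= 2 / eps / r * (Y r - eps / 2 * X r)) by (apply Rmult_le_pos; lra).
  lra.
Qed.

(** If [u] fell below [U], it would equal [U] at some earlier point; the descent bound still applies
    there and reads [8/eps <= (2/eps) X], so [X >= 4], which is too large. *)
Lemma bubble_near s : 0 <= s <= reps -> X s <= 4 - 3 * eps -> U <= u s.
Proof.
intros Hs HX.
destruct (Rle_or_lt U (u s)) as [H|H]; [easy|exfalso].
assert (HG := G_pos).
assert (HUmu : U <= mu).
{ unfold U; assert (0 < 8 / eps / G); [|lra].
  repeat apply Rdiv_lt_0_compat; lra. }
destruct (IVT_continuous u 0 s U) as [x [Hx Hux]]; [lra|auto| |].
{ rewrite u_0; lra. }
assert (HXx : X x <= X s) by (apply X_incr; lra).
assert (H1 := bubble_descent x).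
rewrite Hux in H1.
assert (H2 : G * (mu - U) <= 2 / eps * X x) by (apply H1; lra).
replace (G * (mu - U)) with (2 / eps * 4) in H2 by (unfold U; field; lra).
apply Rmult_le_reg_l in H2; [lra|apply Rdiv_lt_0_compat; lra].
Qed.

(** With [f x = exp (g x)] factored out of the chord bound, a descent of [u] below [x] becomes
    exponential decay of [f] at rate [g x / x]. *)
Lemma f_chord x r : U <= x <= mu -> 0 <= r <= 1 -> u r <= x ->
  f (u r) + 1 <= A * f x * exp (- (g x * (x - u r) / x)).
Proof.
intros Hx Hr Hur.
assert (HT := near_T x Hx).
eapply Rle_trans; [apply (chord x (u r)); trivial|].
{ split; [apply u_range|]; easy. }
rewrite f_exp by easy.
rewrite Rmult_assoc, <- exp_plus.
apply Req_le; do 2 f_equal; field; lra.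
Qed.
Lemma g_pos x : U <= x <= mu -> 0 < g x.
Proof.
intros Hx.
assert (HT := near_T x Hx). assert (Hd := dg_pos x HT). assert (H := near_p x Hx).
assert (0 < x * dg x) by (apply Rmult_lt_0_compat; lra).
destruct (Rle_or_lt (g x) 0) as [Hg|Hg]; [|easy].
assert (0 <= (p + eps) * (- g x)) by (apply Rmult_le_pos; lra).
lra.
Qed.

(** Otherwise [u] is still above [U] at [reps] and [X] gains at most a constant on [[reps, 1]]; then
    [G u] loses too little there for [u] to vanish at [1]. *)
Lemma X_reaches : exists r1, 0 < r1 <= reps /\ X r1 = 4 - 3 * eps.
Proof.
assert (HG := G_pos).
destruct (Rle_or_lt (4 - 3 * eps) (X reps)) as [HX|HX].
{ destruct (IVT_continuous X 0 reps (4 - 3 * eps)) as [x [Hx Hx']].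
  - lra.
  - apply X_cont.
  - unfold X at 1; rewrite m_0; lra.
  - exists x; split; [|easy].
    split; [|easy].
    destruct (Rle_lt_or_eq_dec 0 x (proj1 Hx)) as [H|<-]; [easy|].
    unfold X in Hx'; rewrite m_0 in Hx'; lra. }
exfalso.
assert (HU : U <= u reps) by (apply bubble_near; lra).
assert (Hx : U <= u reps <= mu) by (split; [|apply u_range]; lra).
destruct (phase_curve reps) as [_ HY]; [lra|easy|].
set (C := 12 * (A * hM) / (hm * reps ^ 2)) in *.
assert (HX0 : 0 <= X reps) by (apply X_nonneg; lra).
(* [(2 + eps) X] is at most [9] here; [12] leaves slack. *)
assert (HY12 : Y reps <= 12) by nra.
assert (Hr2 : 0 < reps ^ 2) by (apply pow_lt; lra).
assert (Hff : G * lam * f (u reps) <= 12 / (hm * reps ^ 2)).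
{ apply Rmult_le_reg_r with (hm * reps ^ 2).
  - apply Rmult_lt_0_compat; lra.
  - replace (12 / (hm * reps ^ 2) * (hm * reps ^ 2)) with 12 by (field; lra).
    apply Rle_trans with (2 := HY12); unfold Y.
    replace (G * (lam * (reps * reps) * h reps * f (u reps)))
      with (G * lam * f (u reps) * (h reps * reps ^ 2)) by ring.
    apply Rmult_le_compat_l.
    + apply Rmult_le_pos; [apply Rmult_le_pos; lra|apply f_nonneg].
    + apply Rmult_le_compat_r; [lra|apply h_bnd]. }
assert (HC : forall r, reps <= r <= 1 -> Y r / r <= C).
{ intros r Hr.
  assert (Hur : u r <= u reps) by (apply u_decr; lra).
  assert (Hfr : f (u r) <= A * f (u reps)).
  { assert (H := f_chord (u reps) r Hx ltac:(lra) Hur).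
    assert (exp (- (g (u reps) * (u reps - u r) / u reps)) <= 1).
    { rewrite <- exp_0; apply exp_le_mono.
      assert (0 <= g (u reps) * (u reps - u r) / u reps); [|lra].
      apply Rdiv_le_0_compat; [apply Rmult_le_pos|].
      - now apply Rlt_le, g_pos.
      - lra.
      - assert (H' := near_T _ Hx); lra. }
    assert (0 <= A * f (u reps)) by (apply Rmult_le_pos; [lra|apply f_nonneg]).
    nra. }
  replace (Y r / r) with (G * lam * f (u r) * h r * r) by (unfold Y; field; lra).
  assert (Hp1 : 0 <= G * lam * f (u r)).
  { apply Rmult_le_pos; [apply Rmult_le_pos; lra|apply f_nonneg]. }
  assert (Hh := h_pos r). assert (Hh' := h_bnd r).
  apply Rle_trans with (G * lam * f (u r) * hM).
  { apply Rle_trans with (G * lam * f (u r) * h r).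
    - rewrite <- (Rmult_1_r (G * lam * f (u r) * h r)) at 2.
      apply Rmult_le_compat_l; [apply Rmult_le_pos|]; lra.
    - apply Rmult_le_compat_l; lra. }
  apply Rle_trans with (12 / (hm * reps ^ 2) * A * hM).
  2:{ apply Req_le; unfold C; field; lra. }
  apply Rmult_le_compat_r; [lra|].
  apply Rle_trans with (G * lam * f (u reps) * A).
  - replace (G * lam * f (u reps) * A) with (G * lam * (A * f (u reps))) by ring.
    apply Rmult_le_compat_l; [apply Rmult_le_pos|]; lra.
  - apply Rmult_le_compat_r; lra. }
assert (HC0 : 0 <= C).
{ unfold C; apply Rdiv_le_0_compat; [|apply Rmult_lt_0_compat; lra].
  assert (Hh' := h_bnd 0).
  apply Rmult_le_pos; [|apply Rmult_le_pos]; lra. }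
assert (HXc := X_cont).
assert (HX1 : forall r, reps <= r <= 1 -> X r <= 4 + C).
{ intros r Hr.
  assert (H : X r - C * r <= X reps - C * reps).
  { apply (nonincreasing_of_derive (fun r => X r - C * r) (fun r => Y r / r - C)).
    - lra.
    - intros x _; cont.
    - intros x Hx'; assert (H1 : is_derive X x (Y x / x)) by (apply X_der; lra).
      auto_derive; [eexists; eassumption|].
      deriv H1; ring.
    - intros x Hx'; assert (H := HC x ltac:(lra)); lra. }
  nra. }
(* The slope [X / r] of [- G u] is at most [(4 + C) / reps]; with [u 1 = 0] this contradicts
   [mu_large]. *)
assert (H : G * u reps + (4 + C) / reps * reps <= G * u 1 + (4 + C) / reps * 1).
{ apply (nondecreasing_of_derive (fun r => G * u r + (4 + C) / reps * r)
    (fun r => (4 + C) / reps - X r / r)).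
  - lra.
  - intros x _; cont.
  - intros x Hx'; assert (H1 : is_derive u x (- (m x / x))) by (apply u_der; lra).
    auto_derive; [eexists; eassumption|].
    deriv H1; unfold X; field; lra.
  - intros x Hx'; assert (H := HX1 x ltac:(lra)).
    assert (X x / x <= (4 + C) / reps); [|lra].
    apply Rle_trans with ((4 + C) / x).
    + apply Rmult_le_compat_r; [|easy]; apply Rlt_le, Rinv_0_lt_compat; lra.
    + apply Rmult_le_compat_l; [lra|]; apply Rinv_le_contravar; lra. }
rewrite u_1 in H.
assert (HGU : G * U <= G * u reps) by (apply Rmult_le_compat_l; lra).
replace (G * U) with (G * mu - 8 / eps) in HGU by (unfold U; field; lra).
replace ((4 + C) / reps * reps) with (4 + C) in H by (field; lra).
lra.
Qed.

(** * The region beyond the bubble *)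

Section Outer.

Variable r1 : R.
Hypothesis r1_range : 0 < r1 <= reps.
Hypothesis X_r1 : X r1 = 4 - 3 * eps.

(** [2 + c] is the midpoint of [2], the growth rate of [r^2] in [ln r], and [4/p], the limiting
    decay rate of [f (u r)]; the other half of the gap absorbs the errors in [eps]. *)
Let c := 2 / p - 1.

Lemma u_r1 : U <= u r1 <= mu.
Proof.
split; [apply bubble_near|apply u_range]; lra.
Qed.

(** At [X = 4 - 3 eps] the two curves read [(eps/2) X] and [(9 eps/2 - 3 eps^2/2) X], with
    [1 <= X <= 4]. *)
Lemma Y_r1 : eps / 2 <= Y r1 <= 18 * eps.
Proof.
destruct (phase_curve r1) as [H1 H2]; [lra|apply u_r1|].
rewrite X_r1 in H1, H2; nra.
Qed.

Lemma u_log_decay r : r1 <= r <= 1 ->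
  (4 - 3 * eps) * (ln r - ln r1) <= G * (u r1 - u r).
Proof.
intros Hr.
assert (H : G * u r + (4 - 3 * eps) * ln r <= G * u r1 + (4 - 3 * eps) * ln r1).
2: lra.
apply (nonincreasing_of_derive (fun r => G * u r + (4 - 3 * eps) * ln r)
  (fun r => (4 - 3 * eps - X r) / r)).
- lra.
- intros x Hx; cont; lra.
- intros x Hx; assert (H1 : is_derive u x (- (m x / x))) by (apply u_der; lra).
  auto_derive; [split; [eexists; eassumption|split; lra]|].
  deriv H1; unfold X; field; lra.
- intros x Hx.
  assert (H : X r1 <= X x) by (apply X_incr; lra).
  assert (0 <= (X x - (4 - 3 * eps)) / x); [|lra].
  apply Rdiv_le_0_compat; lra.
Qed.

Lemma c_pos : 0 < c.
Proof.
unfold c; assert (1 < 2 / p); [|lra].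
apply Rmult_lt_reg_r with p; [lra|]; field_simplify; lra.
Qed.

(* The exponent is where [p < 2] enters: [g (u r1) / u r1] is about [G / p], so the decay
   rate of [f (u r)] in [ln r] is about [4 / p], which beats the factor [r ^ 2]. *)
Lemma outer_decay r : r1 <= r <= 1 ->
  G * (lam * (r * r) * h r * (f (u r) + 1))
  <= 18 * eps * (hM / hm * A) * exp (- (c * (ln r - ln r1))).
Proof.
intros Hr.
assert (HG := G_pos). assert (Hu := u_r1).
assert (HT := near_T _ Hu). assert (Hg := g_pos _ Hu).
assert (Hnp := near_p _ Hu). assert (Hnd := near_dg _ Hu).
assert (Hs : 0 <= ln r - ln r1).
{ assert (ln r1 <= ln r); [apply ln_le|]; lra. }
set (s := ln r - ln r1) in *.
assert (Hur : u r <= u r1) by (apply u_decr; lra).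
assert (Hlog := u_log_decay r Hr). fold s in Hlog.
(* [near_dg] and [near_p] give [(1 - eps) * (G * u r1) <= (p + eps) * g (u r1)]; the rest is
   [eps_le]. *)
assert (Hrate : (2 + c) * (G * u r1) <= g (u r1) * (4 - 3 * eps)).
{ assert (Hpc : (2 + c) * (p + eps) <= (4 - 3 * eps) * (1 - eps)).
  { replace ((2 + c) * (p + eps)) with (p + 2 + eps * (1 + 2 / p))
      by (unfold c; field; lra).
    nra. }
  assert (Hc := c_pos).
  apply Rmult_le_reg_r with (1 - eps); [lra|].
  apply Rle_trans with ((2 + c) * (p + eps) * g (u r1)).
  - assert (u r1 * ((1 - eps) * G) <= u r1 * dg (u r1)).
    { apply Rmult_le_compat_l; lra. }
    replace ((2 + c) * (G * u r1) * (1 - eps)) with ((2 + c) * (u r1 * ((1 - eps) * G)))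
      by ring.
    rewrite Rmult_assoc; apply Rmult_le_compat_l; lra.
  - apply Rle_trans with ((4 - 3 * eps) * (1 - eps) * g (u r1)); [|lra].
    apply Rmult_le_compat_r; lra. }
assert (Hexp : (2 + c) * s <= g (u r1) * (u r1 - u r) / u r1).
{ apply Rmult_le_reg_r with (G * u r1); [apply Rmult_lt_0_compat; lra|].
  replace (g (u r1) * (u r1 - u r) / u r1 * (G * u r1))
    with (g (u r1) * (G * (u r1 - u r))) by (field; lra).
  apply Rle_trans with (g (u r1) * ((4 - 3 * eps) * s)).
  - replace ((2 + c) * s * (G * u r1)) with ((2 + c) * (G * u r1) * s) by ring.
    replace (g (u r1) * ((4 - 3 * eps) * s)) with (g (u r1) * (4 - 3 * eps) * s) by ring.
    apply Rmult_le_compat_r; lra.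
  - apply Rmult_le_compat_l; lra. }
assert (Hf : f (u r) + 1 <= A * f (u r1) * exp (- ((2 + c) * s))).
{ eapply Rle_trans; [apply (f_chord (u r1)); trivial; lra|].
  apply Rmult_le_compat_l; [apply Rmult_le_pos; [lra|apply f_nonneg]|].
  apply exp_le_mono; lra. }
assert (Hrr : r * r = r1 * r1 * exp (2 * s)).
{ replace (2 * s) with (ln r - ln r1 + (ln r - ln r1)) by (unfold s; ring).
  unfold Rminus; rewrite !exp_plus, exp_Ropp, !exp_ln by lra; field; lra. }
assert (Hh := h_bnd r). assert (Hh1 := h_bnd r1). assert (HY := Y_r1).
assert (Hlr : 0 <= lam * (r * r)) by (apply Rmult_le_pos; [lra|apply (Rle_0_sqr r)]).
apply Rle_trans with (G * (lam * (r * r) * hM * (A * f (u r1) * exp (- ((2 + c) * s))))).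
{ apply Rmult_le_compat_l; [lra|].
  assert (Hf0 := f_nonneg (u r)).
  apply Rmult_le_compat; try lra.
  - apply Rmult_le_pos; lra.
  - apply Rmult_le_compat_l; lra. }
(* The factor [exp (2 * s)] coming from [r^2] uses up part of the decay; what remains is
   [exp (- (c * s))] times a quantity at [r1] that is already of size [eps]. *)
rewrite Hrr.
replace (exp (- ((2 + c) * s))) with (exp (- (2 * s)) * exp (- (c * s)))
  by (rewrite <- exp_plus; f_equal; ring).
assert (E2 : exp (2 * s) * exp (- (2 * s)) = 1).
{ rewrite <- exp_plus, <- exp_0; f_equal; ring. }
replace (G * (lam * (r1 * r1 * exp (2 * s)) * hM
   * (A * f (u r1) * (exp (- (2 * s)) * exp (- (c * s))))))
  with (Y r1 / h r1 * hM * A * exp (- (c * s)) * (exp (2 * s) * exp (- (2 * s))))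
  by (unfold Y; field; apply Rgt_not_eq, h_pos).
rewrite E2, Rmult_1_r.
apply Rmult_le_compat_r; [apply Rlt_le, exp_pos|].
replace (18 * eps * (hM / hm * A)) with (18 * eps / hm * hM * A) by (field; lra).
do 2 (apply Rmult_le_compat_r; [lra|]).
apply Rmult_le_compat; try lra.
- apply Rlt_le, Rinv_0_lt_compat; lra.
- apply Rinv_le_contravar; lra.
Qed.

(** With [K = 18 (hM/hm) A], [K eps] bounds [Y] and [K eps / c] bounds its integral in [ln r]; [C]
    dominates both and involves neither [eps] nor [u], [lam], [mu]. *)
Let C := 18 * (hM / hm * A) * (1 + / c).

Lemma C_bounds : 0 <= 18 * (hM / hm * A) <= C /\ 18 * (hM / hm * A) / c <= C.
Proof.
assert (Hc := Rinv_0_lt_compat _ c_pos).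
assert (H : 0 <= 18 * (hM / hm * A)).
{ assert (Hh := h_bnd 0).
  repeat apply Rmult_le_pos; try lra.
  apply Rlt_le, Rinv_0_lt_compat; lra. }
unfold C, Rdiv at 3; split; [split|]; nra.
Qed.

Lemma outer_small r : r1 <= r <= 1 ->
  G * (lam * (r * r) * h r * (f (u r) + 1)) <= C * eps.
Proof.
intros Hr; destruct C_bounds as [HK _].
eapply Rle_trans; [now apply outer_decay|].
assert (exp (- (c * (ln r - ln r1))) <= 1).
{ rewrite <- exp_0; apply exp_le_mono.
  assert (Hc := c_pos); assert (ln r1 <= ln r) by (apply ln_le; lra); nra. }
apply Rle_trans with (18 * eps * (hM / hm * A) * 1).
- apply Rmult_le_compat_l; [|easy].
  replace (18 * eps * (hM / hm * A)) with (18 * (hM / hm * A) * eps) by ring.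
  apply Rmult_le_pos; lra.
- nra.
Qed.

(** [K / c * exp (- c s)], with [s = ln r - ln r1], decreases at the rate [K exp (- c s) / r], which
    dominates [X' = Y / r]; so [X] gains at most [K / c]. *)
Lemma X_outer r : r1 <= r <= 1 -> 4 - 3 * eps <= X r <= 4 + C * eps.
Proof.
intros Hr; assert (Hc := c_pos); destruct C_bounds as [HK HKc].
split; [rewrite <- X_r1; apply X_incr; lra|].
set (K := 18 * eps * (hM / hm * A)).
assert (HXc := X_cont).
assert (H : X r + K / c * exp (- (c * (ln r - ln r1)))
  <= X r1 + K / c * exp (- (c * (ln r1 - ln r1)))).
{ apply (nonincreasing_of_derive
    (fun r => X r + K / c * exp (- (c * (ln r - ln r1))))
    (fun r => (Y r - K * exp (- (c * (ln r - ln r1)))) / r)).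
  - lra.
  - intros x Hx; cont; lra.
  - intros x Hx; assert (H1 : is_derive X x (Y x / x)) by (apply X_der; lra).
    auto_derive; [split; [eexists; eassumption|split; lra]|].
    deriv H1; unfold Rminus; field; lra.
  - intros x Hx.
    assert (H := outer_decay x ltac:(lra)); fold K in H.
    assert (HG := G_pos).
    assert (Y x <= G * (lam * (x * x) * h x * (f (u x) + 1))).
    { assert (0 <= G * (lam * (x * x) * h x)); [|unfold Y; lra].
      assert (Hh := h_pos x).
      repeat apply Rmult_le_pos; lra. }
    assert (0 <= (K * exp (- (c * (ln x - ln r1))) - Y x) / x); [|lra].
    apply Rdiv_le_0_compat; lra. }
replace (- (c * (ln r1 - ln r1))) with 0 in H by ring.
rewrite exp_0, X_r1 in H.
assert (0 <= K / c * exp (- (c * (ln r - ln r1)))).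
{ apply Rmult_le_pos; [|apply Rlt_le, exp_pos].
  apply Rdiv_le_0_compat; [|easy].
  unfold K; replace (18 * eps * (hM / hm * A)) with (18 * (hM / hm * A) * eps) by ring.
  apply Rmult_le_pos; lra. }
replace (K / c) with (18 * (hM / hm * A) / c * eps) in * by (unfold K; field; lra).
nra.
Qed.

(** The bounds on [X] are integrated back from [r = 1], where both [u] and [ln] vanish. *)
Lemma u_outer r : r1 <= r <= 1 ->
  (4 - 3 * eps) * - ln r <= G * u r <= (4 + C * eps) * - ln r.
Proof.
intros Hr; split.
- assert (H : G * u 1 + (4 - 3 * eps) * ln 1 <= G * u r + (4 - 3 * eps) * ln r).
  2: rewrite u_1, ln_1 in H; lra.
  apply (nonincreasing_of_derive (fun r => G * u r + (4 - 3 * eps) * ln r)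
    (fun r => (4 - 3 * eps - X r) / r)).
  + lra.
  + intros x Hx; cont; lra.
  + intros x Hx; assert (H1 : is_derive u x (- (m x / x))) by (apply u_der; lra).
    auto_derive; [split; [eexists; eassumption|split; lra]|].
    deriv H1; unfold X; field; lra.
  + intros x Hx; assert (H := X_outer x ltac:(lra)).
    assert (0 <= (X x - (4 - 3 * eps)) / x) by (apply Rdiv_le_0_compat; lra); lra.
- assert (H : G * u r + (4 + C * eps) * ln r <= G * u 1 + (4 + C * eps) * ln 1).
  2: rewrite u_1, ln_1 in H; lra.
  apply (nondecreasing_of_derive (fun r => G * u r + (4 + C * eps) * ln r)
    (fun r => (4 + C * eps - X r) / r)).
  + lra.
  + intros x Hx; cont; lra.
  + intros x Hx; assert (H1 : is_derive u x (- (m x / x))) by (apply u_der; lra).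
    auto_derive; [split; [eexists; eassumption|split; lra]|].
    deriv H1; unfold X; field; lra.
  + intros x Hx; assert (H := X_outer x ltac:(lra)).
    apply Rdiv_le_0_compat; lra.
Qed.

(** * The integral involving the derivative of [f] *)

Variables df J : R -> R.
Variable B : R.
Hypothesis B_nonneg : 0 <= B.
Hypothesis df_dg : forall t, T <= t -> df t = f t * dg t.
Hypothesis df_bnd : forall t, 0 <= t <= mu -> Rabs (df t) <= G * f t + B.
Hypothesis J_cont : forall r, continuous J r.
Hypothesis J_der : forall r, 0 < r < 1 -> is_derive J r (lam * h r * df (u r) * r).
Hypothesis J_0 : J 0 = 0.

(** The outer bound at [r = 1], where the [1] added to [f] alone gives
    [G * lam * h 1 <= C * eps]. *)
Lemma lam_small : lam * dg T * hm <= C * eps.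
Proof.
assert (H := outer_small 1 ltac:(lra)).
apply Rle_trans with (2 := H).
assert (Hh := h_bnd 1). assert (Hf := f_nonneg (u 1)).
assert (HT := dg_pos T ltac:(lra)). assert (HG := dg_incr T mu ltac:(lra) mu_ge).
fold G in HG.
replace (lam * dg T * hm) with (dg T * (lam * (1 * 1) * hm * 1)) by ring.
apply Rmult_le_compat; try lra.
- repeat apply Rmult_le_pos; lra.
- apply Rmult_le_compat; try lra.
  + repeat apply Rmult_le_pos; lra.
  + apply Rmult_le_compat_l; lra.
Qed.

(** On the bubble [df = f dg] with [dg (u r)] between [(1 - eps) G] and [G], so the derivatives of
    [J] and [X] are comparable. *)
Lemma J_inner : (1 - eps) * X r1 <= J r1 <= X r1.
Proof.
assert (X0 : X 0 = 0) by (unfold X; rewrite m_0; ring).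
assert (HXc := X_cont).
assert (Hpos : forall x, 0 < x < r1 -> 0 <= lam * h x * f (u x) * x).
{ intros x Hx; assert (Hh := h_pos x).
  repeat apply Rmult_le_pos; try lra; apply f_nonneg. }
assert (Hslope : forall x, 0 < x < r1 -> T <= u x /\ (1 - eps) * G <= dg (u x) <= G).
{ intros x Hx; assert (Hu := u_r1).
  assert (Hux : u r1 <= u x) by (apply u_decr; lra).
  assert (Hu2 : 0 <= u x <= mu) by (apply u_range; lra).
  assert (HT : T <= u x) by (apply near_T; lra).
  split; [easy|]; split; [apply near_dg|apply dg_incr]; lra. }
split.
- assert (H : J 0 - (1 - eps) * X 0 <= J r1 - (1 - eps) * X r1).
  2: rewrite J_0, X0 in H; lra.
  apply (nondecreasing_of_derive (fun r => J r - (1 - eps) * X r)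
    (fun r => lam * h r * f (u r) * r * (dg (u r) - (1 - eps) * G))).
  + lra.
  + intros x Hx; cont.
  + intros x Hx; destruct (Hslope x Hx) as [HT _].
    assert (H1 : is_derive X x (Y x / x)) by (apply X_der; lra).
    assert (H2 : is_derive J x (lam * h x * df (u x) * x)) by (apply J_der; lra).
    auto_derive; [repeat split; eexists; eassumption|].
    deriv H1; deriv H2; rewrite df_dg by easy; unfold Y; field; lra.
  + intros x Hx; destruct (Hslope x Hx) as [HT HG].
    apply Rmult_le_pos; [auto|lra].
- assert (H : J r1 - X r1 <= J 0 - X 0).
  2: rewrite J_0, X0 in H; lra.
  apply (nonincreasing_of_derive (fun r => J r - X r)
    (fun r => lam * h r * f (u r) * r * (dg (u r) - G))).
  + lra.
  + intros x Hx; cont.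
  + intros x Hx; destruct (Hslope x Hx) as [HT _].
    assert (H1 : is_derive X x (Y x / x)) by (apply X_der; lra).
    assert (H2 : is_derive J x (lam * h x * df (u x) * x)) by (apply J_der; lra).
    auto_derive; [repeat split; eexists; eassumption|].
    deriv H1; deriv H2; rewrite df_dg by easy; unfold Y; field; lra.
  + intros x Hx; destruct (Hslope x Hx) as [HT HG].
    assert (0 <= lam * h x * f (u x) * x * (G - dg (u x))); [|lra].
    apply Rmult_le_pos; [auto|lra].
Qed.

(** [df] may change sign below [T], so the change of [J] is controlled by that of the monotone [X],
    already known to be [O(eps)]; [B] accounts for the values below [T]. *)
Lemma J_outer : Rabs (J 1 - J r1) <= X 1 - X r1 + lam * hM * B.
Proof.
assert (HXc := X_cont).
assert (Hb : forall x, r1 < x < 1 ->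
  Rabs (lam * h x * df (u x) * x) <= Y x / x + lam * hM * B).
{ intros x Hx; assert (Hh := h_bnd x).
  assert (Hl : 0 <= lam * h x) by (apply Rmult_le_pos; lra).
  assert (Hu := df_bnd (u x) ltac:(apply u_range; lra)).
  replace (lam * h x * df (u x) * x) with (lam * h x * x * df (u x)) by ring.
  rewrite Rabs_mult, Rabs_pos_eq by (apply Rmult_le_pos; lra).
  apply Rle_trans with (lam * h x * x * (G * f (u x) + B)).
  - apply Rmult_le_compat_l; [apply Rmult_le_pos|]; lra.
  - replace (Y x / x) with (lam * h x * x * (G * f (u x))) by (unfold Y; field; lra).
    assert (lam * h x * x * B <= lam * hM * B); [|lra].
    apply Rmult_le_compat_r; [lra|].
    rewrite <- (Rmult_1_r (lam * hM)).
    apply Rmult_le_compat; try lra.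
    apply Rmult_le_compat_l; lra. }
assert (HlB : 0 <= lam * hM * B).
{ assert (Hh := h_bnd 0); repeat apply Rmult_le_pos; lra. }
assert (Hder : forall x, r1 < x < 1 ->
  is_derive X x (Y x / x) /\ is_derive J x (lam * h x * df (u x) * x)).
{ intros x Hx; split; [apply X_der|apply J_der]; lra. }
apply Rabs_le; split.
- assert (H : J r1 + X r1 + lam * hM * B * r1 <= J 1 + X 1 + lam * hM * B * 1).
  2: nra.
  apply (nondecreasing_of_derive (fun r => J r + X r + lam * hM * B * r)
    (fun r => lam * h r * df (u r) * r + (Y r / r + lam * hM * B))).
  + lra.
  + intros x Hx; cont.
  + intros x Hx; destruct (Hder x Hx) as [H1 H2].
    auto_derive; [repeat split; eexists; eassumption|].
    deriv H1; deriv H2; ring.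
  + intros x Hx; assert (H := proj1 (Rabs_le_between _ _) (Hb x Hx)); lra.
- assert (H : J 1 - X 1 - lam * hM * B * 1 <= J r1 - X r1 - lam * hM * B * r1).
  2: nra.
  apply (nonincreasing_of_derive (fun r => J r - X r - lam * hM * B * r)
    (fun r => lam * h r * df (u r) * r - (Y r / r + lam * hM * B))).
  + lra.
  + intros x Hx; cont.
  + intros x Hx; destruct (Hder x Hx) as [H1 H2].
    auto_derive; [repeat split; eexists; eassumption|].
    deriv H1; deriv H2; ring.
  + intros x Hx; assert (H := proj1 (Rabs_le_between _ _) (Hb x Hx)); lra.
Qed.

(** [10 = 7 + 3]: [(1 - eps) (4 - 3 eps) >= 4 - 7 eps] on the bubble, and [X] gains at most
    [(C + 3) eps] beyond it. *)
Lemma J_total :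
  Rabs (J 1 - 4) <= (C + 10 + C * (hM / hm) * (B / dg T)) * eps.
Proof.
assert (H1 := J_inner). assert (H2 := J_outer). assert (H3 := lam_small).
assert (H4 := X_outer 1 ltac:(lra)). rewrite X_r1 in *.
assert (HT := dg_pos T ltac:(lra)). assert (Hh := h_bnd 0).
assert (HlB : lam * hM * B <= C * (hM / hm) * (B / dg T) * eps).
{ replace (lam * hM * B) with (lam * dg T * hm * (hM / hm * (B / dg T))) by (field; lra).
  replace (C * (hM / hm) * (B / dg T) * eps) with (C * eps * (hM / hm * (B / dg T)))
    by ring.
  apply Rmult_le_compat_r; [|easy].
  apply Rmult_le_pos; apply Rdiv_le_0_compat; lra. }
apply Rabs_le_between in H2.
apply Rabs_le; split; nra.
Qed.

End Outer.

Theorem bubble_profile :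
  let C := 18 * (hM / hm * A) * (1 + / (2 / p - 1)) in
  exists r1, 0 < r1 <= reps /\ U <= u r1 <= mu /\ eps / 2 <= Y r1 <= 18 * eps /\
  (forall r, r1 <= r <= 1 ->
     4 - 3 * eps <= X r <= 4 + C * eps /\
     0 <= Y r <= C * eps /\
     (4 - 3 * eps) * - ln r <= G * u r <= (4 + C * eps) * - ln r) /\
  (forall df J B, 0 <= B ->
     (forall t, T <= t -> df t = f t * dg t) ->
     (forall t, 0 <= t <= mu -> Rabs (df t) <= G * f t + B) ->
     (forall r, continuous J r) ->
     (forall r, 0 < r < 1 -> is_derive J r (lam * h r * df (u r) * r)) ->
     J 0 = 0 ->
     Rabs (J 1 - 4) <= (C + 10 + C * (hM / hm) * (B / dg T)) * eps).
Proof.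
intros C; destruct X_reaches as [r1 [Hr1 HX]].
exists r1; split; [easy|]; split; [now apply u_r1|]; split; [now apply Y_r1|]; split.
- intros r Hr; split; [now apply (X_outer r1)|]; split; [|now apply (u_outer r1)].
  split; [apply Y_nonneg|].
  eapply Rle_trans; [|now apply (outer_small r1)].
  assert (HG := G_pos); assert (Hh := h_pos r).
  assert (0 <= G * (lam * (r * r) * h r)); [|unfold Y; lra].
  assert (0 <= r * r) by apply (Rle_0_sqr r).
  apply Rmult_le_pos; [lra|apply Rmult_le_pos; [apply Rmult_le_pos|]; lra].
- intros df J B; intros; now apply (J_total r1) with (df := df).
Qed.

End Profile.

Lemma filterlim_Rabs (F : (R -> Prop) -> Prop) {FF : Filter F} (s : R -> R) (l eps : R) :
  filterlim s F (locally l) -> 0 < eps -> F (fun t => Rabs (s t - l) < eps).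
Proof.
intros H He.
exact (proj1 (filterlim_locally s l) H (mkposreal eps He)).
Qed.

Lemma eventually_gt (M : R) : Rbar_locally p_infty (fun t => M < t).
Proof. now exists M. Qed.

(** Suits estimates in which the threshold for [n] depends on [eps] while [K] does not. *)
Lemma is_lim_seq_of_eps (s : nat -> R) (l K eps0 : R) :
  0 < eps0 ->
  (forall eps, 0 < eps <= eps0 -> eventually (fun n => Rabs (s n - l) <= K * eps)) ->
  is_lim_seq s l.
Proof.
intros H0 H; apply is_lim_seq_spec; intros e; simpl.
assert (HK : 0 < Rabs K + 1) by (assert (H1 := Rabs_pos K); lra).
assert (He := cond_pos e).
set (eps := Rmin eps0 (e / (Rabs K + 1) / 2)).
assert (Heps : 0 < eps).
{ apply Rmin_glb_lt; [easy|]; repeat apply Rdiv_lt_0_compat; lra. }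
generalize (H eps (conj Heps (Rmin_l _ _))); apply filter_imp; intros n Hn.
apply Rle_lt_trans with (1 := Hn).
apply Rle_lt_trans with ((Rabs K + 1) * eps).
- apply Rmult_le_compat_r; [lra|]; assert (H1 := Rle_abs K); lra.
- assert (H1 : eps <= e / (Rabs K + 1) / 2) by apply Rmin_r.
  apply (Rmult_le_compat_l (Rabs K + 1)) in H1; [|lra].
  replace ((Rabs K + 1) * (e / (Rabs K + 1) / 2)) with (e / 2) in H1 by (field; lra).
  lra.
Qed.

(** * Growth of the nonlinearity *)

Section Growth.

Variables g dg ddg : R -> R.
Variables T p q : R.
Hypothesis T_pos : 0 < T.
Hypothesis p_pos : 0 < p.
Hypothesis q_gt2 : 2 < q.
Hypothesis g_der : forall t, T <= t -> is_derive g t (dg t).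
Hypothesis dg_der : forall t, T <= t -> is_derive dg t (ddg t).
Hypothesis dg_pos : forall t, T <= t -> 0 < dg t.
Hypothesis ddg_pos : forall t, T <= t -> 0 < ddg t.
Hypothesis lim_q : filterlim (fun t => dg t ^ 2 / (g t * ddg t))
  (Rbar_locally p_infty) (locally q).
Hypothesis lim_p : filterlim (fun t => t * dg t / g t)
  (Rbar_locally p_infty) (locally p).

Lemma g_continuous t : T <= t -> continuous g t.
Proof. intros Ht; apply (ex_derive_continuous g); exists (dg t); auto. Qed.

Lemma dg_continuous t : T <= t -> continuous dg t.
Proof. intros Ht; apply (ex_derive_continuous dg); exists (ddg t); auto. Qed.

Lemma dg_nondecreasing a b : T <= a -> a <= b -> dg a <= dg b.
Proof.
intros Ha Hab; apply (nondecreasing_of_derive dg ddg); trivial.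
- intros x Hx; apply dg_continuous; lra.
- intros x Hx; apply dg_der; lra.
- intros x Hx; apply Rlt_le, ddg_pos; lra.
Qed.

Lemma g_below_tangent a b : T <= a -> a <= b -> g b - g a <= dg b * (b - a).
Proof.
intros Ha Hab.
assert (H : g b - dg b * b <= g a - dg b * a); [|lra].
apply (nonincreasing_of_derive (fun t => g t - dg b * t) (fun t => dg t - dg b)); trivial.
- intros x Hx; cont; apply g_continuous; lra.
- intros x Hx; assert (H1 : is_derive g x (dg x)) by (apply g_der; lra).
  auto_derive; [eexists; eassumption|].
  deriv H1; ring.
- intros x Hx; assert (dg x <= dg b) by (apply dg_nondecreasing; lra); lra.
Qed.

Lemma g_above_tangent a b : T <= a -> a <= b -> dg a * (b - a) <= g b - g a.
Proof.
intros Ha Hab.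
assert (H : g a - dg a * a <= g b - dg a * b); [|lra].
apply (nondecreasing_of_derive (fun t => g t - dg a * t) (fun t => dg t - dg a)); trivial.
- intros x Hx; cont; apply g_continuous; lra.
- intros x Hx; assert (H1 : is_derive g x (dg x)) by (apply g_der; lra).
  auto_derive; [eexists; eassumption|].
  deriv H1; ring.
- intros x Hx; assert (dg a <= dg x) by (apply dg_nondecreasing; lra); lra.
Qed.

Lemma g_unbounded M : Rbar_locally p_infty (fun t => M < g t).
Proof.
assert (HT := dg_pos T ltac:(lra)).
exists (Rmax T (T + (M - g T) / dg T)); intros t Ht.
assert (H1 := Rmax_l T (T + (M - g T) / dg T)).
assert (H2 := Rmax_r T (T + (M - g T) / dg T)).
assert (H := g_above_tangent T t ltac:(lra) ltac:(lra)).
assert (H3 : dg T * ((M - g T) / dg T) < dg T * (t - T)).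
{ apply Rmult_lt_compat_l; lra. }
replace (dg T * ((M - g T) / dg T)) with (M - g T) in H3 by (field; lra).
lra.
Qed.

(** [t g'' / g'] is the quotient of [t g' / g] by [g'^2 / (g g'')], so it tends to [p / q]. *)
Lemma ddg_bound b : p / q < b ->
  Rbar_locally p_infty (fun t => T <= t /\ t * ddg t <= b * dg t).
Proof.
intros Hb.
assert (Hbpos : 0 < p / q) by (apply Rdiv_lt_0_compat; lra).
assert (Hbq : p < b * q).
{ apply Rmult_lt_reg_r with (/ q); [apply Rinv_0_lt_compat; lra|].
  rewrite Rmult_assoc, Rinv_r, Rmult_1_r by lra; exact Hb. }
(* The first entry is the largest [e] with [p + e <= b (q - e)]; the cap [1] keeps [q - e]
   positive. *)
set (e := Rmin ((b * q - p) / (1 + b)) 1).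
assert (He : 0 < e).
{ apply Rmin_glb_lt; [apply Rdiv_lt_0_compat|]; lra. }
assert (He1 : p + e <= b * (q - e)).
{ assert (H := Rmin_l ((b * q - p) / (1 + b)) 1); fold e in H.
  apply (Rmult_le_compat_r (1 + b)) in H; [|lra].
  replace ((b * q - p) / (1 + b) * (1 + b)) with (b * q - p) in H by (field; lra).
  lra. }
assert (He2 : e <= 1) by apply Rmin_r.
assert (H1 := filterlim_Rabs _ _ _ e lim_p He).
assert (H2 := filterlim_Rabs _ _ _ e lim_q He).
assert (H3 := g_unbounded 0). assert (H4 := eventually_gt T).
generalize (filter_and _ _ (filter_and _ _ H1 H2) (filter_and _ _ H3 H4)).
apply filter_imp; intros t [[Hx Hy] [Hg Ht]].
split; [lra|].
assert (Hd := dg_pos t ltac:(lra)). assert (Hdd := ddg_pos t ltac:(lra)).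
apply Rabs_lt_between in Hx; apply Rabs_lt_between in Hy.
set (x := t * dg t / g t) in *.
set (y := dg t ^ 2 / (g t * ddg t)) in *.
assert (Hxy : t * ddg t * y = dg t * x) by (unfold x, y; field; lra).
apply Rmult_le_reg_r with y; [lra|].
rewrite Hxy.
replace (b * dg t * y) with (dg t * (b * y)) by ring.
apply Rmult_le_compat_l; [lra|].
assert (b * (q - e) <= b * y) by (apply Rmult_le_compat_l; lra).
lra.
Qed.

(* A one-sided l'Hopital rule: [(t g')' / g' = 1 + t g'' / g'] tends to [1 + p / q]. *)
Lemma p_le : p <= 1 + p / q.
Proof.
destruct (Rle_or_lt p (1 + p / q)) as [H|H]; [easy|exfalso].
(* The midpoint of [p / q] and [p - 1], so that [p = 1 + b + 2 d] with [d > 0]. *)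
set (b := (p / q + p - 1) / 2).
assert (Hb : p / q < b) by (unfold b; lra).
destruct (ddg_bound b Hb) as [M HM].
set (M' := M + 1).
assert (HMT : T <= M') by (apply HM; unfold M'; lra).
set (d := (p - (1 + b)) / 2).
assert (Hd : 0 < d) by (unfold d, b; lra).
(* [phi' = b g' - t g''] is eventually nonnegative, whereas [t g' / g > p - d] forces [phi < - d g],
   which tends to minus infinity. *)
set (phi := fun t => (1 + b) * g t - t * dg t).
assert (H1 := filterlim_Rabs _ _ _ d lim_p Hd).
assert (H2 := g_unbounded (Rmax 0 (- phi M' / d))).
assert (H3 := eventually_gt M').
destruct (filter_and _ _ (filter_and _ _ H1 H2) H3) as [N HN].
destruct (HN (N + 1) ltac:(lra)) as [[Hp' Hg] Ht].
set (t := N + 1) in *.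
assert (Hg0 := Rle_lt_trans _ _ _ (Rmax_l _ _) Hg).
assert (Hg1 := Rle_lt_trans _ _ _ (Rmax_r _ _) Hg).
assert (Hphi : phi M' <= phi t).
{ apply (nondecreasing_of_derive phi (fun s => b * dg s - s * ddg s)).
  - lra.
  - intros x Hx; unfold phi; cont; [apply g_continuous|apply dg_continuous]; lra.
  - intros x Hx; unfold phi.
    assert (D1 : is_derive g x (dg x)) by (apply g_der; lra).
    assert (D2 : is_derive dg x (ddg x)) by (apply dg_der; lra).
    auto_derive; [repeat split; eexists; eassumption|].
    deriv D1; deriv D2; ring.
  - intros x Hx; destruct (HM x) as [_ Hx']; [unfold M' in Hx; lra|lra]. }
unfold phi at 2 in Hphi.
apply Rabs_lt_between in Hp'.
assert (H4 : (p - d) * g t < t * dg t).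
{ apply Rmult_lt_reg_r with (/ g t); [now apply Rinv_0_lt_compat|].
  rewrite Rmult_assoc, Rinv_r by lra; unfold Rdiv in Hp'; lra. }
assert (H5 : - phi M' / d * d < g t * d) by (apply Rmult_lt_compat_r; lra).
replace (- phi M' / d * d) with (- phi M') in H5 by (field; lra).
replace (p - d) with (1 + b + d) in H4 by (unfold d; field).
lra.
Qed.

(** Since [q > 2], [p <= 1 + p/q < 1 + p/2]. *)
Lemma p_lt_2 : p < 2.
Proof.
assert (H := p_le).
assert (p / q * q = p) by (field; lra).
assert (0 < p / q) by (apply Rdiv_lt_0_compat; lra).
nra.
Qed.

(** The window has bounded width, at most [D / dg T], while [g'' <= b g' / t] makes the relative
    variation of [g'] per unit length [O(1/t)]. *)
Lemma dg_slowly_varying D e : 0 < D -> 0 < e ->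
  Rbar_locally p_infty (fun x => forall t, x - D / dg x <= t <= x ->
    (1 - e) * dg x <= dg t).
Proof.
intros HD He.
assert (HT := dg_pos T ltac:(lra)).
set (b := p / q + 1).
assert (Hb0 : 0 < p / q) by (apply Rdiv_lt_0_compat; lra).
destruct (ddg_bound b ltac:(unfold b; lra)) as [M HM].
set (D' := D / dg T).
assert (HD' : 0 < D') by (apply Rdiv_lt_0_compat; lra).
exists (Rmax T (Rmax M (b * D' / e)) + D'); intros x Hx t Ht.
assert (R1 := Rmax_l T (Rmax M (b * D' / e))).
assert (R2 := Rmax_r T (Rmax M (b * D' / e))).
assert (R3 := Rmax_l M (b * D' / e)).
assert (R4 := Rmax_r M (b * D' / e)).
assert (HDx : D / dg x <= D').
{ apply Rmult_le_compat_l; [lra|].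
  apply Rinv_le_contravar; [easy|]; apply dg_nondecreasing; lra. }
assert (Hdx := dg_pos x ltac:(lra)).
(* A bound for [ddg] on all of [[t, x]], as [dg s <= dg x] and [s >= t]. *)
set (k := b * dg x / t).
assert (H : dg x - k * x <= dg t - k * t).
{ apply (nonincreasing_of_derive (fun s => dg s - k * s) (fun s => ddg s - k)).
  - lra.
  - intros s Hs; cont; apply dg_continuous; lra.
  - intros s Hs; assert (D1 : is_derive dg s (ddg s)) by (apply dg_der; lra).
    auto_derive; [eexists; eassumption|].
    deriv D1; ring.
  - intros s Hs; destruct (HM s ltac:(lra)) as [_ H1].
    assert (H2 : dg s <= dg x) by (apply dg_nondecreasing; lra).
    assert (H3 := ddg_pos s ltac:(lra)).
    assert (ddg s <= k); [|lra].
    unfold k; apply Rmult_le_reg_r with t; [lra|].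
    replace (b * dg x / t * t) with (b * dg x) by (field; lra).
    apply Rle_trans with (b * dg s).
    + assert (ddg s * t <= ddg s * s) by (apply Rmult_le_compat_l; lra); lra.
    + apply Rmult_le_compat_l; unfold b; lra. }
assert (Hk : k * (x - t) <= e * dg x).
{ apply Rle_trans with (k * D').
  - apply Rmult_le_compat_l; [|lra].
    unfold k; apply Rdiv_le_0_compat; [apply Rmult_le_pos|]; unfold b; lra.
  - apply Rmult_le_reg_r with t; [lra|].
    replace (k * D' * t) with (dg x * (b * D')) by (unfold k; field; lra).
    replace (e * dg x * t) with (dg x * (e * t)) by ring.
    apply Rmult_le_compat_l; [lra|].
    replace (b * D') with (e * (b * D' / e)) by (field; lra).
    apply Rmult_le_compat_l; lra. }
lra.
Qed.

Lemma shift_gt D M : 0 < D ->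
  Rbar_locally p_infty (fun x => T <= x /\ M < x - D / dg x).
Proof.
intros HD.
assert (HT := dg_pos T ltac:(lra)).
assert (HD' : 0 < D / dg T) by (apply Rdiv_lt_0_compat; lra).
exists (Rmax T (M + D / dg T)); intros x Hx.
assert (R1 := Rmax_l T (M + D / dg T)).
assert (R2 := Rmax_r T (M + D / dg T)).
assert (HDx : D / dg x <= D / dg T).
{ apply Rmult_le_compat_l; [lra|].
  apply Rinv_le_contravar; [easy|]; apply dg_nondecreasing; lra. }
lra.
Qed.

(** The window swept by the bubble moves off to infinity, so asymptotic properties hold on all of
    it. *)
Lemma shift_eventually D (P : R -> Prop) : 0 < D ->
  Rbar_locally p_infty P ->
  Rbar_locally p_infty (fun x => forall t, x - D / dg x <= t <= x -> P t).
Proof.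
intros HD [M HM].
generalize (shift_gt D M HD); apply filter_imp; intros x Hx t Ht; apply HM; lra.
Qed.

Lemma tdg_le e : 0 < e ->
  Rbar_locally p_infty (fun t => t * dg t <= (p + e) * g t).
Proof.
intros He.
generalize (filter_and _ _ (filterlim_Rabs _ _ _ e lim_p He) (g_unbounded 0)).
apply filter_imp; intros t [H Hg].
apply Rabs_lt_between in H.
apply Rlt_le, Rmult_lt_reg_r with (/ g t); [now apply Rinv_0_lt_compat|].
rewrite (Rmult_assoc (p + e)), Rinv_r by lra; unfold Rdiv in H; lra.
Qed.

Lemma tdg_unbounded M : Rbar_locally p_infty (fun t => M < dg t * t).
Proof.
assert (HT := dg_pos T ltac:(lra)).
exists (Rmax T (M / dg T)); intros t Ht.
assert (R1 := Rmax_l T (M / dg T)).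
assert (R2 := Rmax_r T (M / dg T)).
assert (H1 : dg T * (M / dg T) < dg T * t) by (apply Rmult_lt_compat_l; lra).
replace (dg T * (M / dg T)) with M in H1 by (field; lra).
assert (dg T <= dg t) by (apply dg_nondecreasing; lra).
assert (dg T * t <= dg t * t) by (apply Rmult_le_compat_r; lra).
lra.
Qed.

(** From [t g' <= (p + 1) g] and large [t]; it makes [ln g'(mu_n)] negligible against [g(mu_n)]. *)
Lemma dg_over_g e : 0 < e ->
  Rbar_locally p_infty (fun t => dg t <= e * g t).
Proof.
intros He.
generalize (filter_and _ _ (filter_and _ _ (tdg_le 1 Rlt_0_1) (g_unbounded 0))
  (filter_and _ _ (eventually_gt T) (eventually_gt ((p + 1) / e)))).
apply filter_imp; intros t [[H Hg] [Ht1 Ht2]].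
assert (H1 : p + 1 < e * t).
{ replace (p + 1) with (e * ((p + 1) / e)) by (field; lra).
  apply Rmult_lt_compat_l; lra. }
apply Rmult_le_reg_l with t; [lra|].
apply Rle_trans with (1 := H).
replace (t * (e * g t)) with (e * t * g t) by ring.
apply Rmult_le_compat_r; lra.
Qed.

(** Convexity puts [g] below its chord over [[T, x]]; replacing this by the line from the origin
    costs a factor [exp |g T|]. In the constant, [B] covers [[0, T]] and [1] the summand added to
    [f]. *)
Lemma chord_bound (f : R -> R) (B : R) :
  (forall t, T <= t -> f t = exp (g t)) ->
  (forall t, 0 <= t <= T -> f t <= B) -> 0 <= B ->
  Rbar_locally p_infty (fun x => forall t, 0 <= t <= x ->
    f t + 1 <= (exp (Rabs (g T)) + 1 + B) * exp (g x * t / x)).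
Proof.
intros Hf HB HB0.
generalize (filter_and _ _ (eventually_gt T) (g_unbounded 0)).
apply filter_imp; intros x [Hx Hg] t Ht.
assert (Hgt : 0 <= g x * t / x) by (apply Rdiv_le_0_compat; [apply Rmult_le_pos|]; lra).
assert (H1 : 1 <= exp (g x * t / x)) by (rewrite <- exp_0; now apply exp_le_mono).
assert (Hex := exp_pos (Rabs (g T))).
destruct (Rle_or_lt t T) as [HtT|HtT].
- assert (H := HB t ltac:(lra)); nra.
- rewrite Hf by lra.
  assert (exp (g t) <= exp (Rabs (g T)) * exp (g x * t / x)); [|nra].
  rewrite <- exp_plus; apply exp_le_mono.
  assert (A1 := g_below_tangent T t ltac:(lra) ltac:(lra)).
  assert (A2 := g_above_tangent t x ltac:(lra) ltac:(lra)).
  assert (Hd := dg_pos t ltac:(lra)).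
  assert (A3 : (g t - g T) * (x - t) <= (g x - g t) * (t - T)).
  { apply Rle_trans with (dg t * (t - T) * (x - t)).
    - apply Rmult_le_compat_r; lra.
    - replace (dg t * (t - T) * (x - t)) with (dg t * (x - t) * (t - T)) by ring.
      apply Rmult_le_compat_r; lra. }
  assert (B1 := Rle_abs (g T)). assert (B2 := Rabs_pos (g T)).
  assert (C1 : g x * (t - T) <= g x * t / x * (x - T)).
  { replace (g x * t / x * (x - T)) with (g x * (t - T + T * (x - t) / x)) by (field; lra).
    apply Rmult_le_compat_l; [lra|].
    assert (0 <= T * (x - t) / x); [|lra].
    apply Rdiv_le_0_compat; [apply Rmult_le_pos|]; lra. }
  apply Rmult_le_reg_r with (x - T); [lra|].
  assert (C2 : g T * (x - t) <= Rabs (g T) * (x - T)) by nra.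
  lra.
Qed.

(** * Limits along the sequence *)

Section Family.

Variables h dh f df : R -> R.
Variables hm hM Bh Bf Bdf : R.
Variables lam mu : nat -> R.
Variables u m J : nat -> R -> R.

Hypothesis h_cont : forall r, continuous h r.
Hypothesis h_der : forall r, 0 < r < 1 -> is_derive h r (dh r).
Hypothesis hm_pos : 0 < hm.
Hypothesis h_bnd : forall r, hm <= h r <= hM.
Hypothesis dh_bnd : forall r, 0 < r < 1 -> Rabs (dh r) <= Bh.

Hypothesis f_cont : forall t, continuous f t.
Hypothesis f_nonneg : forall t, 0 <= f t.
Hypothesis f_exp : forall t, T <= t -> f t = exp (g t).
Hypothesis f_der : forall t, T <= t -> is_derive f t (f t * dg t).
Hypothesis df_dg : forall t, T <= t -> df t = f t * dg t.
Hypothesis f_bnd : forall t, 0 <= t <= T -> f t <= Bf.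
Hypothesis df_bnd : forall t, 0 <= t <= T -> Rabs (df t) <= Bdf.

Hypothesis lam_pos : forall n, 0 < lam n.
Hypothesis u_cont : forall n r, continuous (u n) r.
Hypothesis m_cont : forall n r, continuous (m n) r.
Hypothesis u_der : forall n r, 0 < r < 1 -> is_derive (u n) r (- (m n r / r)).
Hypothesis m_der : forall n r, 0 < r < 1 ->
  is_derive (m n) r (lam n * h r * f (u n r) * r).
Hypothesis m_0 : forall n, m n 0 = 0.
Hypothesis u_0 : forall n, u n 0 = mu n.
Hypothesis u_1 : forall n, u n 1 = 0.
Hypothesis mu_lim : is_lim_seq mu p_infty.
Hypothesis J_cont : forall n r, continuous (J n) r.
Hypothesis J_der : forall n r, 0 < r < 1 ->
  is_derive (J n) r (lam n * h r * df (u n r) * r).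
Hypothesis J_0 : forall n, J n 0 = 0.

Let A := exp (Rabs (g T)) + 1 + Bf.
Let C := 18 * (hM / hm * A) * (1 + / (2 / p - 1)).
Let CJ := C + 10 + C * (hM / hm) * (Bdf / dg T).
(** The two entries encode [eps_le4] and [eps_le]. *)
Let eps0 := Rmin (1 / 4) ((2 - p) / (8 + 2 / p)).
Let Y n r := dg (mu n) * (lam n * (r * r) * h r * f (u n r)).

Let p2 : p < 2 := p_lt_2.

Lemma eps0_pos : 0 < eps0.
Proof.
assert (0 < 2 / p) by (apply Rdiv_lt_0_compat; lra).
apply Rmin_glb_lt; [lra|apply Rdiv_lt_0_compat; lra].
Qed.

Lemma Bf_nonneg : 0 <= Bf.
Proof. apply Rle_trans with (f 0); [apply f_nonneg|apply f_bnd; lra]. Qed.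

Lemma Bdf_nonneg : 0 <= Bdf.
Proof. apply Rle_trans with (Rabs (df 0)); [apply Rabs_pos|apply df_bnd; lra]. Qed.

Lemma C_nonneg : 0 <= C.
Proof.
assert (Hh := h_bnd 0). assert (HB := Bf_nonneg). assert (HE := exp_pos (Rabs (g T))).
assert (1 < 2 / p).
{ apply Rmult_lt_reg_r with p; [lra|]; field_simplify; lra. }
assert (0 < / (2 / p - 1)) by (apply Rinv_0_lt_compat; lra).
unfold C, A; apply Rmult_le_pos; [|lra].
apply Rmult_le_pos; [lra|].
apply Rmult_le_pos; [apply Rdiv_le_0_compat|]; lra.
Qed.

Lemma mu_eventually (P : R -> Prop) :
  Rbar_locally p_infty P -> eventually (fun n => P (mu n)).
Proof. exact (mu_lim P). Qed.

Lemma eventually_profile eps a : 0 < eps <= eps0 -> 0 < a ->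
  eventually (fun n => exists r1, 0 < r1 <= a /\ r1 < 1 /\
    T <= u n r1 /\ mu n - 8 / eps / dg (mu n) <= u n r1 <= mu n /\
    eps / 2 <= Y n r1 <= 18 * eps /\
    (forall r, r1 <= r <= 1 ->
      4 - 3 * eps <= dg (mu n) * m n r <= 4 + C * eps /\
      0 <= Y n r <= C * eps /\
      (4 - 3 * eps) * - ln r <= dg (mu n) * u n r <= (4 + C * eps) * - ln r) /\
    Rabs (J n 1 - 4) <= CJ * eps).
Proof.
intros [Heps Heps0] Ha.
assert (Hp2 : 0 < 2 / p) by (apply Rdiv_lt_0_compat; lra).
assert (E1 : eps <= 1 / 4) by (eapply Rle_trans; [exact Heps0|apply Rmin_l]).
assert (E2 : eps * (8 + 2 / p) <= 2 - p).
{ assert (H : eps <= (2 - p) / (8 + 2 / p)) by (eapply Rle_trans; [exact Heps0|apply Rmin_r]).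
  apply (Rmult_le_compat_r (8 + 2 / p)) in H; [|lra].
  replace ((2 - p) / (8 + 2 / p) * (8 + 2 / p)) with (2 - p) in H by (field; lra).
  exact H. }
assert (HBh : 0 <= Bh).
{ apply Rle_trans with (2 := dh_bnd (1 / 2) ltac:(lra)); apply Rabs_pos. }
(* The entries ensure [r1 <= a], [reps < 1] and [|r h'/h| <= eps]. None involves [n], so [mu_large]
   holds eventually. *)
set (reps := Rmin a (Rmin (1 / 2) (eps * hm / (Bh + 1)))).
assert (R0 : 0 < reps).
{ repeat apply Rmin_glb_lt; try lra.
  apply Rdiv_lt_0_compat; [apply Rmult_lt_0_compat|]; lra. }
assert (R1 : reps <= a) by apply Rmin_l.
assert (R2 : reps <= 1 / 2) by (eapply Rle_trans; [apply Rmin_r|apply Rmin_l]).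
assert (R3 : reps * (Bh + 1) <= eps * hm).
{ assert (H : reps <= eps * hm / (Bh + 1)) by (eapply Rle_trans; [apply Rmin_r|apply Rmin_r]).
  apply (Rmult_le_compat_r (Bh + 1)) in H; [|lra].
  replace (eps * hm / (Bh + 1) * (Bh + 1)) with (eps * hm) in H by (field; lra).
  exact H. }
assert (HD : 0 < 8 / eps) by (apply Rdiv_lt_0_compat; lra).
assert (F1 := shift_gt (8 / eps) T HD).
assert (F2 := dg_slowly_varying (8 / eps) eps HD Heps).
assert (F3 := shift_eventually (8 / eps) _ HD
  (tdg_le eps Heps)).
assert (F4 := shift_eventually (8 / eps) _ HD
  (chord_bound f Bf f_exp f_bnd Bf_nonneg)).
assert (F5 := tdg_unbounded
  (8 / eps + (4 + 12 * (A * hM) / (hm * reps ^ 2)) / reps)).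
generalize (mu_eventually _ (filter_and _ _ (filter_and _ _ F1 F2)
  (filter_and _ _ F3 (filter_and _ _ F4 F5)))).
apply filter_imp; intros n [[[N1 N1'] N2] [N3 [N4 N5]]].
destruct (bubble_profile h dh f g dg (u n) (m n) (lam n) (mu n) T A hm hM p eps reps)
  as [r1 [P1 [P2 [P3 [P4 P5]]]]]; auto; try lra.
- intros a' b Ha' Hb; now apply dg_nondecreasing.
- intros r Hr; assert (Hh := h_bnd r).
  assert (Hd := dh_bnd r ltac:(lra)).
  unfold Rdiv; rewrite !Rabs_mult, Rabs_inv, (Rabs_pos_eq r), (Rabs_pos_eq (h r)) by lra.
  apply Rmult_le_reg_r with (h r); [lra|].
  rewrite Rmult_assoc, Rinv_l, Rmult_1_r by lra.
  assert (H0 := Rabs_pos (dh r)).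
  assert (r * Rabs (dh r) <= reps * (Bh + 1)) by (apply Rmult_le_compat; lra).
  assert (eps * hm <= eps * h r) by (apply Rmult_le_compat_l; lra).
  lra.
- assert (HE := exp_pos (Rabs (g T))); assert (HB := Bf_nonneg); unfold A; lra.
- intros t Ht; lra.
- exists r1; split; [lra|]; split; [lra|]; split; [lra|]; split; [easy|].
  split; [exact P3|]; split; [exact P4|].
  apply (P5 df (J n) Bdf); auto.
  + apply Bdf_nonneg.
  + intros t Ht.
    assert (HB := Bdf_nonneg); assert (Hf := f_nonneg t).
    assert (Hmu := dg_pos _ N1).
    destruct (Rle_or_lt T t) as [HT|HT].
    * rewrite df_dg by easy.
      assert (Hd := dg_pos _ HT).
      rewrite Rabs_pos_eq by (apply Rmult_le_pos; lra).
      assert (dg t <= dg (mu n)) by (apply dg_nondecreasing; lra).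
      assert (f t * dg t <= f t * dg (mu n)) by (apply Rmult_le_compat_l; lra).
      lra.
    * assert (H := df_bnd t ltac:(lra)).
      assert (0 <= dg (mu n) * f t) by (apply Rmult_le_pos; lra); lra.
Qed.

Lemma mass_lim : is_lim_seq (fun n => dg (mu n) * m n 1) 4.
Proof.
assert (HC := C_nonneg).
apply is_lim_seq_of_eps with (K := C + 3) (eps0 := eps0); [apply eps0_pos|].
intros eps Heps.
generalize (eventually_profile eps 1 Heps Rlt_0_1).
apply filter_imp; intros n [r1 [H1 [H1' [_ [_ [_ [H _]]]]]]].
destruct (H 1 ltac:(lra)) as [HX _].
apply Rabs_le; nra.
Qed.

Lemma J_lim : is_lim_seq (fun n => J n 1) 4.
Proof.
apply is_lim_seq_of_eps with (K := CJ) (eps0 := eps0); [apply eps0_pos|].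
intros eps Heps.
generalize (eventually_profile eps 1 Heps Rlt_0_1).
apply filter_imp; intros n [r1 [_ [_ [_ [_ [_ [_ H]]]]]]]; exact H.
Qed.

Lemma local_uniform a eps : 0 < a <= 1 -> 0 < eps ->
  eventually (fun n => forall r, a <= r <= 1 ->
    Rabs (dg (mu n) * u n r + 4 * ln r) <= eps /\
    Rabs (dg (mu n) * m n r - 4) <= eps /\
    0 <= Y n r <= eps).
Proof.
intros Ha Heps.
assert (HC := C_nonneg).
assert (Hla : 0 <= - ln a).
{ assert (ln a <= ln 1) by (apply ln_le; lra); rewrite ln_1 in *; lra. }
(* [1 - ln a] covers both the plain errors and those multiplied by [- ln r <= - ln a]. *)
set (K := (C + 3) * (1 - ln a)).
assert (HK : 0 < K) by (apply Rmult_lt_0_compat; lra).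
set (e := Rmin eps0 (eps / K)).
assert (He : 0 < e <= eps0).
{ split; [apply Rmin_glb_lt; [apply eps0_pos|apply Rdiv_lt_0_compat; lra]|apply Rmin_l]. }
assert (HKe : K * e <= eps).
{ assert (H : e <= eps / K) by apply Rmin_r.
  apply (Rmult_le_compat_l K) in H; [|lra].
  replace (K * (eps / K)) with eps in H by (field; lra); exact H. }
generalize (eventually_profile e a He (proj1 Ha)).
apply filter_imp; intros n [r1 [H1 [H1' [_ [_ [_ [H _]]]]]]] r Hr.
destruct (H r ltac:(lra)) as [HX [HY HU]].
assert (Hlr : 0 <= - ln r <= - ln a).
{ assert (ln a <= ln r) by (apply ln_le; lra).
  assert (ln r <= ln 1) by (apply ln_le; lra); rewrite ln_1 in *; lra. }
assert (H0 : 0 <= C * e) by (apply Rmult_le_pos; lra).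
assert (H2 : 0 <= (C + 3) * e * - ln a).
{ apply Rmult_le_pos; [apply Rmult_le_pos|]; lra. }
assert (H3 : (C + 3) * e <= eps) by (unfold K in HKe; lra).
assert (H4 : (C + 3) * e * - ln r <= eps).
{ apply Rle_trans with ((C + 3) * e * - ln a); [|unfold K in HKe; lra].
  apply Rmult_le_compat_l; lra. }
assert (H5 : 0 <= e * - ln r) by (apply Rmult_le_pos; lra).
assert (H6 : 0 <= C * (e * - ln r)) by (apply Rmult_le_pos; lra).
split; [apply Rabs_le; lra|].
split; [apply Rabs_le; lra|lra].
Qed.

(* Taking logarithms in the definition of [Y n r1], where [- ln r1] is about
   [g' (mu n) mu n / 4] because [u n] has logarithmic slope about [4 / g' (mu n)] on [r1, 1]. *)
Lemma ln_lam_estimate eps : 0 < eps <= eps0 -> exists K, eventually (fun n =>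
  Rabs (- ln (lam n) - (g (mu n) - dg (mu n) * mu n / 2))
  <= K + dg (mu n) + (3 + C) / 2 * eps * (dg (mu n) * mu n)).
Proof.
intros Heps.
assert (HC := C_nonneg).
assert (E1 : eps <= 1 / 4) by (eapply Rle_trans; [apply Heps|apply Rmin_l]).
exists (Rabs (ln (dg T)) + Rabs (ln hm) + Rabs (ln hM) + Rabs (ln (eps / 2))
  + Rabs (ln (18 * eps)) + 8 / eps + 4 / eps).
generalize (filter_and _ _ (eventually_profile eps 1 Heps Rlt_0_1)
  (mu_eventually _ (eventually_gt T))).
apply filter_imp; intros n [[r1 [H1 [H1' [HT [Hu [HY [H _]]]]]]] Hmu].
destruct (H r1 ltac:(lra)) as [_ [_ HL]].
set (G := dg (mu n)) in *. set (L := - ln r1) in *.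
assert (HG : 0 < G) by (apply dg_pos; lra).
assert (HGT : dg T <= G) by (apply dg_nondecreasing; lra).
assert (HdT := dg_pos T ltac:(lra)).
assert (Hh := h_bnd r1). assert (Hlam := lam_pos n).
assert (He8 : 0 < 8 / eps) by (apply Rdiv_lt_0_compat; lra).
assert (HlnY : ln (Y n r1) = ln G + ln (lam n) - 2 * L + ln (h r1) + g (u n r1)).
{ unfold Y; fold G; rewrite f_exp by easy.
  assert (P1 : 0 < r1 * r1) by (apply Rmult_lt_0_compat; lra).
  assert (P2 := exp_pos (g (u n r1))).
  rewrite !ln_mult, ln_exp by (repeat apply Rmult_lt_0_compat; lra).
  unfold L; ring. }
assert (A1 : ln (eps / 2) <= ln (Y n r1) <= ln (18 * eps)) by (split; apply ln_le; lra).
assert (A2 : ln hm <= ln (h r1) <= ln hM) by (split; apply ln_le; lra).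
assert (A3 : ln (dg T) <= ln G) by (apply ln_le; lra).
assert (A4 : ln G <= G).
{ assert (Hx := exp_ineq1_le (ln G)); rewrite exp_ln in Hx; lra. }
assert (A5 : g (mu n) - 8 / eps <= g (u n r1) <= g (mu n)).
{ assert (B1 := g_below_tangent (u n r1) (mu n) HT ltac:(lra)).
  assert (B2 := g_above_tangent (u n r1) (mu n) HT ltac:(lra)).
  assert (B3 : 0 <= dg (u n r1) * (mu n - u n r1)).
  { apply Rmult_le_pos; [apply Rlt_le, dg_pos|]; lra. }
  assert (B4 : G * (mu n - u n r1) <= G * (8 / eps / G)) by (apply Rmult_le_compat_l; lra).
  replace (G * (8 / eps / G)) with (8 / eps) in B4 by (field; lra).
  fold G in B1; lra. }
assert (A6 : G * mu n - 8 / eps <= G * u n r1 <= G * mu n).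
{ assert (B4 : G * (mu n - 8 / eps / G) <= G * u n r1) by (apply Rmult_le_compat_l; lra).
  replace (G * (mu n - 8 / eps / G)) with (G * mu n - 8 / eps) in B4 by (field; lra).
  split; [easy|apply Rmult_le_compat_l; lra]. }
assert (HL0 : 0 <= L).
{ assert (ln r1 <= ln 1) by (apply ln_le; lra); rewrite ln_1 in *; unfold L; lra. }
(* As [4 - 3 eps >= 1], the lower bound on [u] gives [L <= G * u n r1 <= G * mu n]. *)
assert (A7 : eps * L <= eps * (G * mu n)).
{ apply Rmult_le_compat_l; [lra|].
  assert (3 * eps * L <= 3 * L) by nra; nra. }
assert (A8 : C * (eps * L) <= C * (eps * (G * mu n))) by (apply Rmult_le_compat_l; lra).
assert (A9 : 0 <= eps * L) by (apply Rmult_le_pos; lra).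
assert (A10 : 0 <= C * (eps * L)) by (apply Rmult_le_pos; lra).
assert (Q1 := proj1 (Rabs_le_between (ln (dg T)) _) (Rle_refl _)).
assert (Q2 := proj1 (Rabs_le_between (ln hm) _) (Rle_refl _)).
assert (Q3 := proj1 (Rabs_le_between (ln hM) _) (Rle_refl _)).
assert (Q4 := proj1 (Rabs_le_between (ln (eps / 2)) _) (Rle_refl _)).
assert (Q5 := proj1 (Rabs_le_between (ln (18 * eps)) _) (Rle_refl _)).
replace (4 / eps) with (8 / eps / 2) by (field; lra).
apply Rabs_le; lra.
Qed.

Lemma ln_lam_lim : is_lim_seq (fun n => ln (/ lam n) / g (mu n)) ((2 - p) / 2).
Proof.
assert (HC := C_nonneg).
(* In units of [eps * g (mu n)], [3] dominates [1] from the constant of [ln_lam_estimate], [1] from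
   [dg (mu n)] and [1/2] from [t g'/g - p]; the last term uses [t g'/g <= p + 1]. *)
apply is_lim_seq_of_eps with (K := 3 + (3 + C) / 2 * (p + 1)) (eps0 := eps0);
  [apply eps0_pos|].
intros eps Heps.
assert (E1 : eps <= 1 / 4) by (eapply Rle_trans; [apply Heps|apply Rmin_l]).
destruct (ln_lam_estimate eps Heps) as [K HK].
assert (F1 := filterlim_Rabs _ _ _ eps lim_p (proj1 Heps)).
assert (F2 := dg_over_g eps (proj1 Heps)).
assert (F3 := g_unbounded (Rmax 0 (K / eps))).
generalize (filter_and _ _ HK (mu_eventually _ (filter_and _ _ F1 (filter_and _ _ F2 F3)))).
apply filter_imp; intros n [H [N1 [N2 N3]]].
assert (Hg0 := Rle_lt_trans _ _ _ (Rmax_l _ _) N3).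
assert (Hg1 := Rle_lt_trans _ _ _ (Rmax_r _ _) N3).
rewrite ln_Rinv by apply lam_pos.
set (x := mu n * dg (mu n) / g (mu n)) in *.
assert (Hx : dg (mu n) * mu n = x * g (mu n)) by (unfold x; field; lra).
rewrite Hx in H.
assert (HKg : K < eps * g (mu n)).
{ replace K with (eps * (K / eps)) by (field; lra).
  apply Rmult_lt_compat_l; lra. }
apply Rabs_lt_between in N1.
apply Rabs_le_between in H.
assert (Hxp : (3 + C) / 2 * eps * (x * g (mu n)) <= (3 + C) / 2 * (p + 1) * (eps * g (mu n))).
{ replace ((3 + C) / 2 * eps * (x * g (mu n))) with ((3 + C) / 2 * x * (eps * g (mu n)))
    by ring.
  apply Rmult_le_compat_r; [apply Rmult_le_pos; lra|].
  apply Rmult_le_compat_l; lra. }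
assert (Hxg : - eps * g (mu n) <= (x - p) * g (mu n) <= eps * g (mu n)).
{ split; apply Rmult_le_compat_r; lra. }
apply Rabs_le; split.
- apply Rmult_le_reg_r with (g (mu n)); [lra|].
  replace ((- ln (lam n) / g (mu n) - (2 - p) / 2) * g (mu n))
    with (- ln (lam n) - (2 - p) / 2 * g (mu n)) by (field; lra).
  lra.
- apply Rmult_le_reg_r with (g (mu n)); [lra|].
  replace ((- ln (lam n) / g (mu n) - (2 - p) / 2) * g (mu n))
    with (- ln (lam n) - (2 - p) / 2 * g (mu n)) by (field; lra).
  lra.
Qed.

Theorem blow_up_limits :
  is_lim_seq (fun n => dg (mu n) * m n 1) 4 /\
  is_lim_seq (fun n => J n 1) 4 /\
  (forall a eps, 0 < a <= 1 -> 0 < eps ->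
    eventually (fun n => forall r, a <= r <= 1 ->
      Rabs (dg (mu n) * u n r + 4 * ln r) <= eps /\
      Rabs (dg (mu n) * m n r - 4) <= eps /\
      0 <= Y n r <= eps)) /\
  is_lim_seq (fun n => ln (/ lam n) / g (mu n)) ((2 - p) / 2).
Proof.
split; [exact mass_lim|split; [exact J_lim|split; [exact local_uniform|exact ln_lam_lim]]].
Qed.

End Family.

End Growth.

(** * One-sided derivatives on intervals *)

Lemma has_deriv_on_cont_on D f df : has_deriv_on D f df -> cont_on D f.
Proof.
intros H x Hx.
apply filterlim_locally; intros eps.
assert (He := cond_pos eps).
destruct (proj1 (filterlim_locally _ _) (H x Hx) (mkposreal 1 Rlt_0_1)) as [d Hd].
assert (Hk : 0 < Rabs (df x) + 1) by (assert (H0 := Rabs_pos (df x)); lra).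
assert (Hd' : 0 < Rmin d (eps / (Rabs (df x) + 1))).
{ apply Rmin_glb_lt; [apply cond_pos|now apply Rdiv_lt_0_compat]. }
exists (mkposreal _ Hd'); intros y Hy HDy.
destruct (Req_dec y x) as [->|Hne]; [apply ball_center|].
change (Rabs (y - x) < Rmin d (eps / (Rabs (df x) + 1))) in Hy.
assert (Hq : Rabs ((f y - f x) / (y - x) - df x) < 1).
{ apply (Hd y); [|now split].
  exact (Rlt_le_trans _ _ _ Hy (Rmin_l _ _)). }
change (Rabs (f y - f x) < eps).
replace (f y - f x) with (((f y - f x) / (y - x) - df x + df x) * (y - x)) by (field; lra).
rewrite Rabs_mult.
assert (Hy2 : Rabs (y - x) < eps / (Rabs (df x) + 1)) by exact (Rlt_le_trans _ _ _ Hy (Rmin_r _ _)).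
apply Rle_lt_trans with ((Rabs (df x) + 1) * Rabs (y - x)).
- apply Rmult_le_compat_r; [apply Rabs_pos|].
  eapply Rle_trans; [apply Rabs_triang|]; lra.
- replace (pos eps) with ((Rabs (df x) + 1) * (eps / (Rabs (df x) + 1))) by (field; lra).
  now apply Rmult_lt_compat_l.
Qed.

Lemma has_deriv_on_is_derive D f df x :
  has_deriv_on D f df -> locally x D -> is_derive f x (df x).
Proof.
intros H HD.
assert (Hx := locally_singleton _ _ HD).
apply is_derive_Reals; intros eps He.
destruct (filter_and _ _ HD (proj1 (filterlim_locally _ _) (H x Hx) (mkposreal eps He)))
  as [d Hd].
exists d; intros y Hy0 Hy.
destruct (Hd (x + y)) as [HDy Hq].
{ change (Rabs (x + y - x) < d); now replace (x + y - x) with y by ring. }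
assert (Hq' : Rabs ((f (x + y) - f x) / (x + y - x) - df x) < eps).
{ apply Hq; split; [easy|lra]. }
now replace (x + y - x) with y in Hq' by ring.
Qed.

(** [pr y] tends to [pr x] without leaving [D], so continuity relative to [D] suffices; data given
    on an interval thus become continuous on the whole line. *)
Lemma cont_on_retract (D : R -> Prop) (f pr : R -> R) : cont_on D f ->
  (forall x, D (pr x)) -> (forall x, continuous pr x) ->
  forall x, continuous (fun y => f (pr y)) x.
Proof.
intros Hf HD Hpr x P HP.
assert (H : locally x (fun y => D (pr y) -> P (f (pr y)))).
{ exact (Hpr x _ (Hf (pr x) (HD x) P HP)). }
change (locally x (fun y => P (f (pr y)))).
revert H; apply filter_imp; intros y Hy; exact (Hy (HD y)).
Qed.

Lemma continuous_Rmax_l (a x : R) : continuous (Rmax a) x.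
Proof.
assert (E : forall y : R, (a + y + Rabs (y - a)) / 2 = Rmax a y).
{ intros y; unfold Rmax; destruct (Rle_dec a y).
  - rewrite Rabs_pos_eq by lra; field.
  - rewrite Rabs_left by lra; field. }
apply (continuous_ext _ _ _ E).
assert (H : forall y, continuous Rabs y) by (intros; apply continuous_Rabs).
cont.
Qed.

Lemma continuous_Rmin_l (a x : R) : continuous (Rmin a) x.
Proof.
assert (E : forall y : R, - Rmax (- a) (- y) = Rmin a y).
{ intros y; unfold Rmax, Rmin; destruct (Rle_dec a y), (Rle_dec (- a) (- y)); lra. }
apply (continuous_ext _ _ _ E).
assert (H := continuous_Rmax_l (- a)).
cont.
Qed.

Definition clamp (x : R) : R := Rmax 0 (Rmin 1 x).

Lemma clamp_I01 x : I01 (clamp x).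
Proof.
unfold I01, clamp, Rmax, Rmin; destruct (Rle_dec 1 x); destruct (Rle_dec 0 _); lra.
Qed.

Lemma clamp_id x : 0 <= x <= 1 -> clamp x = x.
Proof.
intros; unfold clamp, Rmax, Rmin; destruct (Rle_dec 1 x); destruct (Rle_dec 0 _); lra.
Qed.

Lemma clamp_continuous x : continuous clamp x.
Proof.
assert (H0 := continuous_Rmax_l 0). assert (H1 := continuous_Rmin_l 1).
exact (continuous_comp (Rmin 1) (Rmax 0) x (H1 x) (H0 _)).
Qed.

Lemma locally_interval a b x : a < x < b -> locally x (fun y => a < y < b).
Proof.
intros Hx; apply (open_and (fun y => a < y) (fun y => y < b)).
- apply open_gt.
- apply open_lt.
- exact Hx.
Qed.

Lemma is_derive_clamp (f : R -> R) (l x : R) : 0 < x < 1 -> is_derive f x l ->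
  is_derive (fun y => f (clamp y)) x l.
Proof.
intros Hx; apply is_derive_ext_loc.
generalize (locally_interval 0 1 x Hx); apply filter_imp.
intros y Hy; now rewrite clamp_id by lra.
Qed.

Lemma continuous_bounded (F : R -> R) (a b : R) : a <= b -> (forall x, continuous F x) ->
  exists B, forall x, a <= x <= b -> Rabs (F x) <= B.
Proof.
intros Hab HF.
destruct (continuity_ab_maj (fun x => Rabs (F x)) a b Hab) as [x [Hx _]].
- intros c _; apply continuity_pt_filterlim.
  apply (continuous_comp F Rabs); [apply HF|apply continuous_Rabs].
- now exists (Rabs (F x)).
Qed.

Lemma is_derive_RInt_0 (k : R -> R) (x : R) : (forall x, continuous k x) ->
  is_derive (fun r => RInt k 0 r) x (k x).
Proof.
intros Hk; apply (is_derive_RInt k (fun r => RInt k 0 r) 0); [|apply Hk].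
apply filter_forall; intros r; apply (RInt_correct k).
apply (ex_RInt_continuous k); auto.
Qed.

(** The clamped functions need not be differentiable at [0] and [1]; [F] minus the integral has zero
    derivative inside, so the two monotonicity lemmas make it constant. *)
Lemma RInt_of_derive (F k : R -> R) : (forall x, continuous F x) -> (forall x, continuous k x) ->
  (forall x, 0 < x < 1 -> is_derive F x (k x)) -> RInt k 0 1 = F 1 - F 0.
Proof.
intros HF Hk Hd.
assert (HI : forall x, continuous (fun r => RInt k 0 r) x).
{ intros x; apply (ex_derive_continuous (fun r => RInt k 0 r)).
  exists (k x); now apply is_derive_RInt_0. }
assert (Hc : forall x, continuous (fun r => F r - RInt k 0 r) x) by (intros x; cont).
assert (Hd0 : forall x, 0 < x < 1 -> is_derive (fun r => F r - RInt k 0 r) x 0).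
{ intros x Hx; apply is_derive_value with (k x - k x); [|ring].
  apply (is_derive_minus F (fun r => RInt k 0 r)); [now apply Hd|].
  now apply is_derive_RInt_0. }
assert (H1 : F 0 - RInt k 0 0 <= F 1 - RInt k 0 1).
{ apply (nondecreasing_of_derive (fun r => F r - RInt k 0 r) (fun _ => 0)); auto; intros; lra. }
assert (H2 : F 1 - RInt k 0 1 <= F 0 - RInt k 0 0).
{ apply (nonincreasing_of_derive (fun r => F r - RInt k 0 r) (fun _ => 0)); auto; intros; lra. }
rewrite (RInt_point 0 k) in *; change (@zero _) with 0 in *; lra.
Qed.

(** Carries the bound on [u''] to [r = 1]: the differential equation is given only inside [(0, 1)],
    and [u''] is continuous up to the boundary. *)
Lemma Rabs_le_at_right_end (w : R -> R) (b c : R) : b < 1 -> continuous w 1 ->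
  (forall r, b <= r < 1 -> Rabs (w r) <= c) -> Rabs (w 1) <= c.
Proof.
intros Hb Hw H.
apply Rnot_lt_le; intros Hlt.
assert (Hc : continuous (fun r => Rabs (w r)) 1).
{ apply (continuous_comp w Rabs); [easy|apply continuous_Rabs]. }
destruct (Hc (fun y => c < y) (open_gt c _ Hlt)) as [d Hd].
assert (Hd0 := cond_pos d).
set (r := Rmax b (1 - d / 2)).
assert (Hr : b <= r < 1) by (split; [apply Rmax_l|apply Rmax_lub_lt; lra]).
assert (Hr2 : 1 - d / 2 <= r) by apply Rmax_r.
specialize (H r Hr).
assert (c < Rabs (w r)); [|lra].
apply Hd; change (Rabs (r - 1) < d); apply Rabs_lt_between; lra.
Qed.

(** * Application to the given solutions *)

Theorem theoremA1
  (* h in C^1([0,1]), h > 0 *)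
  (h h' : R -> R)
  (Hh_der : has_deriv_on I01 h h') (Hh'_cont : cont_on I01 h')
  (Hh_pos : forall r, I01 r -> 0 < h r)
  (* f in C^1([0,oo)), f >= 0 *)
  (f f' : R -> R)
  (Hf_der : has_deriv_on (Ige 0) f f') (Hf'_cont : cont_on (Ige 0) f')
  (Hf_nonneg : forall t, 0 <= t -> 0 <= f t)
  (* t0 >= 0, f > 0 on [t0,oo), f in C^2([t0,oo)) *)
  (t0 : R) (Ht0 : 0 <= t0)
  (Hf_pos : forall t, t0 <= t -> 0 < f t)
  (f'' : R -> R)
  (Hf'_der : has_deriv_on (Ige t0) f' f'') (Hf''_cont : cont_on (Ige t0) f'')
  (* g = log f on [t0,oo), with derivatives g', g'' *)
  (g' g'' : R -> R)
  (Hg_der : has_deriv_on (Ige t0) (fun t => ln (f t)) g')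
  (Hg'_der : has_deriv_on (Ige t0) g' g'')
  (* condition (H1) with q > 2 (so q in (1,oo), p in (0,oo); (ii) vacuous) *)
  (q p : R) (Hq : 2 < q) (Hp : 0 < p)
  (Hg'_pos : forall t, t0 <= t -> 0 < g' t)
  (Hg''_pos : forall t, t0 <= t -> 0 < g'' t)
  (Hlim_q : filterlim (fun t => (g' t) ^ 2 / (ln (f t) * g'' t))
              (Rbar_locally p_infty) (locally q))
  (Hlim_p : filterlim (fun t => t * g' t / ln (f t))
              (Rbar_locally p_infty) (locally p))
  (* the sequence of solutions (lambda_n, mu_n, u_n), u_n in C^2([0,1]) *)
  (lam mu : nat -> R) (u u' u'' : nat -> R -> R)
  (Hlam : forall n, 0 < lam n) (Hmu : forall n, 0 < mu n)
  (Hu_der : forall n, has_deriv_on I01 (u n) (u' n))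
  (Hu'_der : forall n, has_deriv_on I01 (u' n) (u'' n))
  (Hu''_cont : forall n, cont_on I01 (u'' n))
  (Heq : forall n r, 0 < r < 1 ->
     - u'' n r - / r * u' n r = lam n * h r * f (u n r))
  (Hu_pos : forall n r, 0 < r < 1 -> 0 < u n r)
  (Hu0 : forall n, u n 0 = mu n)
  (Hu'0 : forall n, u' n 0 = 0)
  (Hu1 : forall n, u n 1 = 0)
  (Hmu_lim : is_lim_seq mu p_infty) :
  is_lim_seq (fun n => g' (mu n) *
                RInt (fun r => lam n * h r * f (u n r) * r) 0 1) 4
  /\ is_lim_seq (fun n => RInt (fun r => lam n * h r * f' (u n r) * r) 0 1) 4
  /\ (* g'(mu_n) u_n -> 4 log(1/r) in C^2_loc((0,1]) *)
     (forall a, 0 < a <= 1 -> forall eps, 0 < eps ->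
        exists N : nat, forall n, (N <= n)%nat -> forall r, a <= r <= 1 ->
          Rabs (g' (mu n) * u n r - 4 * ln (/ r)) < eps
          /\ Rabs (g' (mu n) * u' n r - (- 4 / r)) < eps
          /\ Rabs (g' (mu n) * u'' n r - 4 / r ^ 2) < eps)
  /\ is_lim_seq (fun n => ln (/ lam n) / ln (f (mu n))) ((2 - p) / 2).
Proof.
set (T := t0 + 1).
set (g := fun t => ln (f t)).
set (fc := fun t => f (Rmax 0 t)).
set (dfc := fun t => f' (Rmax 0 t)).
set (hc := fun r => h (clamp r)).
set (uc := fun n r => u n (clamp r)).
set (mc := fun n r => - (clamp r * u' n (clamp r))).
set (kf := fun n s => lam n * hc s * fc (uc n s) * s).
set (kdf := fun n s => lam n * hc s * dfc (uc n s) * s).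
set (J := fun n r => RInt (kdf n) 0 r).
assert (HRm : forall x, continuous (Rmax 0) x) by apply continuous_Rmax_l.
assert (HI0 : forall x, Ige 0 (Rmax 0 x)) by (intros x; apply Rmax_l).
assert (Hin : forall r, 0 < r < 1 -> locally r I01).
{ intros r Hr; generalize (locally_interval 0 1 r Hr); apply filter_imp.
  unfold I01; intros; lra. }
assert (Hint : forall a t, a < t -> locally t (Ige a)).
{ intros a t Ht; generalize (locally_interval a (t + 1) t ltac:(lra)); apply filter_imp.
  unfold Ige; intros; lra. }
assert (Hhc : forall r, continuous hc r).
{ apply (cont_on_retract I01 h clamp); [|apply clamp_I01|apply clamp_continuous].
  exact (has_deriv_on_cont_on _ _ _ Hh_der). }
assert (Hh'c : forall r, continuous (fun r => h' (clamp r)) r).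
{ now apply (cont_on_retract I01 h' clamp); [|apply clamp_I01|apply clamp_continuous]. }
assert (Hfc : forall t, continuous fc t).
{ apply (cont_on_retract (Ige 0) f (Rmax 0)); trivial.
  exact (has_deriv_on_cont_on _ _ _ Hf_der). }
assert (Hdfc : forall t, continuous dfc t) by now apply (cont_on_retract (Ige 0) f' (Rmax 0)).
assert (Huc : forall n r, continuous (uc n) r).
{ intros n; apply (cont_on_retract I01 (u n) clamp); [|apply clamp_I01|apply clamp_continuous].
  exact (has_deriv_on_cont_on _ _ _ (Hu_der n)). }
assert (Hu'c : forall n r, continuous (fun r => u' n (clamp r)) r).
{ intros n; apply (cont_on_retract I01 (u' n) clamp); [|apply clamp_I01|apply clamp_continuous].
  exact (has_deriv_on_cont_on _ _ _ (Hu'_der n)). }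
assert (Hu''c : forall n r, continuous (fun r => u'' n (clamp r)) r).
{ intros n.
  now apply (cont_on_retract I01 (u'' n) clamp); [|apply clamp_I01|apply clamp_continuous]. }
assert (Hmc : forall n r, continuous (mc n) r).
{ intros n r; unfold mc.
  apply (continuous_opp (fun r => clamp r * u' n (clamp r))).
  apply (continuous_mult clamp (fun r => u' n (clamp r))); [apply clamp_continuous|auto]. }
assert (Hkf : forall n r, continuous (kf n) r).
{ intros n r; assert (H := Huc n); unfold kf; cont. }
assert (Hkdf : forall n r, continuous (kdf n) r).
{ intros n r; assert (H := Huc n); unfold kdf; cont. }
assert (HT : 0 < T) by (unfold T; lra).
assert (Hgd : forall t, T <= t -> is_derive g t (g' t)).
{ intros t Ht; apply (has_deriv_on_is_derive _ _ _ _ Hg_der), Hint; unfold T in Ht; lra. }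
assert (Hg'd : forall t, T <= t -> is_derive g' t (g'' t)).
{ intros t Ht; apply (has_deriv_on_is_derive _ _ _ _ Hg'_der), Hint; unfold T in Ht; lra. }
assert (Hg'p : forall t, T <= t -> 0 < g' t) by (intros t Ht; apply Hg'_pos; unfold T in Ht; lra).
assert (Hg''p : forall t, T <= t -> 0 < g'' t)
  by (intros t Ht; apply Hg''_pos; unfold T in Ht; lra).
assert (Hfcf : forall t, 0 <= t -> fc t = f t).
{ intros t Ht; unfold fc; now rewrite Rmax_right. }
assert (Hdfcf : forall t, 0 <= t -> dfc t = f' t).
{ intros t Ht; unfold dfc; now rewrite Rmax_right. }
assert (Hfd : forall t, 0 < t -> is_derive f t (f' t)).
{ intros t Ht; apply (has_deriv_on_is_derive _ _ _ _ Hf_der), Hint; lra. }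
(* Both [g'] and [f' / f] are derivatives of [ln f]. *)
assert (Hf'g : forall t, T <= t -> f' t = f t * g' t).
{ intros t Ht.
  assert (Hft : 0 < f t) by (apply Hf_pos; unfold T in Ht; lra).
  assert (D1 := Hfd t ltac:(lra)).
  assert (D2 : is_derive g t (f' t / f t)).
  { unfold g; auto_derive; [split; [eexists; eassumption|split; trivial]|].
    deriv D1; field; lra. }
  assert (E := is_derive_unique _ _ _ (Hgd t Ht)).
  rewrite (is_derive_unique _ _ _ D2) in E; rewrite <- E; field; lra. }
assert (Hfexp : forall t, T <= t -> fc t = exp (g t)).
{ intros t Ht; rewrite Hfcf by lra; unfold g; rewrite exp_ln; trivial.
  apply Hf_pos; unfold T in Ht; lra. }
assert (Hfder : forall t, T <= t -> is_derive fc t (fc t * g' t)).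
{ intros t Ht; rewrite Hfcf, <- Hf'g by lra.
  apply (is_derive_ext_loc f); [|apply Hfd; lra].
  generalize (Hint 0 t ltac:(lra)); apply filter_imp.
  intros y Hy; now rewrite Hfcf. }
assert (Hdfdg : forall t, T <= t -> dfc t = fc t * g' t).
{ intros t Ht; rewrite Hfcf, Hdfcf by lra; auto. }
assert (Hfn : forall t, 0 <= fc t) by (intros t; apply Hf_nonneg, HI0).
destruct (continuous_bounded fc 0 T ltac:(lra) Hfc) as [Bf HBf].
destruct (continuous_bounded dfc 0 T ltac:(lra) Hdfc) as [Bdf HBdf].
assert (HBf' : forall t, 0 <= t <= T -> fc t <= Bf).
{ intros t Ht; eapply Rle_trans; [apply Rle_abs|auto]. }
destruct (continuous_bounded hc 0 1 ltac:(lra) Hhc) as [hM HhM].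
destruct (continuous_bounded (fun r => h' (clamp r)) 0 1 ltac:(lra) Hh'c) as [Bh HBh].
destruct (continuity_ab_min hc 0 1 ltac:(lra)) as [rm [Hrm _]].
{ intros r _; apply continuity_pt_filterlim, Hhc. }
assert (Hhm : 0 < hc rm) by apply Hh_pos, clamp_I01.
assert (Hhb : forall r, hc rm <= hc r <= hM).
{ intros r.
  replace (hc r) with (hc (clamp r))
    by (unfold hc; now rewrite (clamp_id (clamp r)) by apply clamp_I01).
  split; [apply Hrm, clamp_I01|].
  eapply Rle_trans; [apply Rle_abs|apply HhM, clamp_I01]. }
assert (Hhd : forall r, 0 < r < 1 -> is_derive hc r (h' r)).
{ intros r Hr; apply is_derive_clamp; [easy|].
  apply (has_deriv_on_is_derive _ _ _ _ Hh_der); auto. }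
assert (Hh'b : forall r, 0 < r < 1 -> Rabs (h' r) <= Bh).
{ intros r Hr; assert (H := HBh r ltac:(lra)); now rewrite clamp_id in H by lra. }
assert (Huv : forall n r, 0 <= r <= 1 -> uc n r = u n r).
{ intros n r Hr; unfold uc; now rewrite clamp_id. }
assert (Hmv : forall n r, 0 <= r <= 1 -> mc n r = - (r * u' n r)).
{ intros n r Hr; unfold mc; now rewrite clamp_id. }
assert (Hhv : forall r, 0 <= r <= 1 -> hc r = h r).
{ intros r Hr; unfold hc; now rewrite clamp_id. }
assert (Hud : forall n r, 0 < r < 1 -> is_derive (uc n) r (- (mc n r / r))).
{ intros n r Hr; apply is_derive_clamp; [easy|].
  rewrite Hmv by lra; replace (- (- (r * u' n r) / r)) with (u' n r) by (field; lra).
  apply (has_deriv_on_is_derive _ _ _ _ (Hu_der n)); auto. }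
assert (Hmd : forall n r, 0 < r < 1 -> is_derive (mc n) r (lam n * hc r * fc (uc n r) * r)).
{ intros n r Hr; apply (is_derive_clamp (fun r => - (r * u' n r))); [easy|].
  assert (D1 : is_derive (u' n) r (u'' n r)).
  { apply (has_deriv_on_is_derive _ _ _ _ (Hu'_der n)); auto. }
  assert (Hpos := Hu_pos n r Hr).
  rewrite Huv, Hhv, Hfcf, <- Heq by lra.
  auto_derive; [eexists; eassumption|].
  deriv D1; field; lra. }
assert (Hm0 : forall n, mc n 0 = 0) by (intros n; rewrite Hmv by lra; ring).
assert (Hu0c : forall n, uc n 0 = mu n) by (intros n; rewrite Huv by lra; auto).
assert (Hu1c : forall n, uc n 1 = 0) by (intros n; rewrite Huv by lra; auto).
assert (HJd : forall n r, is_derive (J n) r (kdf n r)).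
{ intros n r; apply is_derive_RInt_0; auto. }
assert (HJc : forall n r, continuous (J n) r).
{ intros n r; apply (ex_derive_continuous (J n)); exists (kdf n r); auto. }
assert (HJ0 : forall n, J n 0 = 0) by (intros n; apply (RInt_point 0 (kdf n))).
assert (HJd' : forall n r, 0 < r < 1 ->
  is_derive (J n) r (lam n * hc r * dfc (uc n r) * r)) by (intros; apply HJd).
destruct (blow_up_limits g g' g'' T p q HT Hp Hq Hgd Hg'd Hg'p Hg''p Hlim_q Hlim_p
  hc h' fc dfc (hc rm) hM Bh Bf Bdf lam mu uc mc J) as [L1 [L2 [L3 L4]]]; trivial.
split; [|split; [|split]].
- apply is_lim_seq_ext with (fun n => g' (mu n) * mc n 1).
  + intros n; f_equal.
    rewrite (RInt_ext _ (kf n)).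
    * rewrite (RInt_of_derive (mc n) (kf n)); [rewrite Hm0; ring|auto..].
    * intros r; rewrite Rmin_left, Rmax_right by lra; intros Hr.
      assert (Hpos := Hu_pos n r Hr).
      unfold kf; now rewrite Huv, Hhv, Hfcf by lra.
  + exact L1.
- apply is_lim_seq_ext with (fun n => J n 1).
  + intros n; apply RInt_ext; intros r; rewrite Rmin_left, Rmax_right by lra; intros Hr.
    assert (Hpos := Hu_pos n r Hr).
    unfold kdf; now rewrite Huv, Hhv, Hdfcf by lra.
  + exact L2.
- intros a Ha eps Heps.
  (* Even for [a = 1] this leaves points to the left of [1] from which the bound on [u''] passes to
     the endpoint. *)
  set (b := a / 2).
  assert (Hb : 0 < b < 1) by (unfold b; lra).
  assert (Hb2 : 0 < b ^ 2 <= 1) by (split; [apply pow_lt|]; nra).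
  (* The error of [u''] is [2 eta / r^2 <= eps / 2], which stays below [eps] after passing to the
     endpoint. *)
  set (eta := eps * b ^ 2 / 4).
  assert (Heta : 0 < eta) by (apply Rdiv_lt_0_compat; [apply Rmult_lt_0_compat|]; lra).
  assert (Hloc : eventually (fun n => forall r, b <= r <= 1 ->
    Rabs (g' (mu n) * uc n r + 4 * ln r) <= eta /\
    Rabs (g' (mu n) * mc n r - 4) <= eta /\
    0 <= g' (mu n) * (lam n * (r * r) * hc r * fc (uc n r)) <= eta)).
  { apply L3; lra. }
  destruct Hloc as [N HN]; exists N; intros n Hn.
  assert (Hu''b : forall r, b <= r <= 1 ->
    Rabs (g' (mu n) * u'' n (clamp r) - 4 * / (r ^ 2)) <= eps / 2).
  { assert (Hlt : forall r, b <= r < 1 ->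
      Rabs (g' (mu n) * u'' n (clamp r) - 4 * / (r ^ 2)) <= eps / 2).
    { intros r Hr; rewrite clamp_id by lra.
      destruct (HN n Hn r ltac:(lra)) as [_ [H2 H3]].
      assert (Hpos := Hu_pos n r ltac:(lra)).
      rewrite Hmv in H2 by lra.
      rewrite Huv, Hhv, Hfcf in H3 by lra.
      assert (E := Heq n r ltac:(lra)).
      assert (Hr2 : b ^ 2 <= r ^ 2) by (apply pow_incr; lra).
      set (Z := g' (mu n) * (lam n * (r * r) * h r * f (u n r))) in *.
      (* The equation reads [r^2 u'' = - r u' - r^2 lam h f(u)], so the numerator is [X - 4 - Y]. *)
      replace (g' (mu n) * u'' n r - 4 * / (r ^ 2))
        with ((g' (mu n) * - (r * u' n r) - 4 - Z) / r ^ 2).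
      2:{ replace (u'' n r) with (- / r * u' n r - lam n * h r * f (u n r)) by lra.
          unfold Z; field; lra. }
      unfold Rdiv; rewrite Rabs_mult, Rabs_inv, (Rabs_pos_eq (r ^ 2)) by lra.
      apply Rmult_le_reg_r with (r ^ 2); [lra|].
      rewrite Rmult_assoc, Rinv_l, Rmult_1_r by lra.
      apply Rle_trans with (2 * eta).
      - apply Rabs_le_between in H2; apply Rabs_le; lra.
      - unfold eta; nra. }
    intros r Hr; destruct (Rle_lt_or_eq_dec r 1 (proj2 Hr)) as [Hr1| ->]; [apply Hlt; lra|].
    apply (Rabs_le_at_right_end (fun r => g' (mu n) * u'' n (clamp r) - 4 * / (r ^ 2)) b);
      [lra| |exact Hlt].
    apply (continuous_minus (fun r => g' (mu n) * u'' n (clamp r)) (fun r => 4 * / (r ^ 2))).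
    - apply (continuous_mult (fun _ => g' (mu n)) (fun r => u'' n (clamp r))); cont.
      apply Hu''c.
    - apply (ex_derive_continuous (fun r : R => 4 * / (r ^ 2))); auto_derive; lra. }
  intros r Hr.
  assert (Hbr : b <= r <= 1) by (unfold b; lra).
  destruct (HN n Hn r Hbr) as [H1 [H2 _]].
  rewrite Huv in H1 by lra; rewrite Hmv in H2 by lra.
  assert (Hee : eta <= eps / 4 * b).
  { unfold eta; replace (eps * b ^ 2 / 4) with (eps / 4 * b * b) by field.
    rewrite <- (Rmult_1_r (eps / 4 * b)) at 2.
    apply Rmult_le_compat_l; [apply Rmult_le_pos|]; lra. }
  assert (Hee2 : eta < eps) by nra.
  split; [|split].
  + rewrite ln_Rinv by lra.
    replace (g' (mu n) * u n r - 4 * - ln r) with (g' (mu n) * u n r + 4 * ln r) by ring.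
    lra.
  + replace (g' (mu n) * u' n r - -4 / r) with (- ((g' (mu n) * - (r * u' n r) - 4) / r))
      by (field; lra).
    rewrite Rabs_Ropp; unfold Rdiv; rewrite Rabs_mult, Rabs_inv, (Rabs_pos_eq r) by lra.
    apply Rmult_lt_reg_r with r; [lra|].
    rewrite Rmult_assoc, Rinv_l, Rmult_1_r by lra.
    apply Rle_lt_trans with (1 := H2); nra.
  + assert (H := Hu''b r Hbr); rewrite clamp_id in H by lra; unfold Rdiv; lra.
- change (fun n => ln (/ lam n) / ln (f (mu n))) with (fun n => ln (/ lam n) / g (mu n)).
  exact L4.
Qed.
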